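(* Let $k\in\mathbb{Z}^{+}$ and let $G$ be a multigraph (loops and multiple edges allowed) with $\mathcal{S}(G)\geq 2k$. Let $V_1=V_1(G)$, $F=F(G)$ and $\alpha'=\alpha'(F)$. Then $G$ does not contain $k$ (vertex-)disjoint cycles if and only if $$|V(G)|-|V_1|-2\alpha'<3(k-|V_1|-\alpha'),$$ i.e., if and only if $|V(G)|+2|V_1|+\alpha'<3k$.
   Context: Multigraphs may have loops and multiple edges. A cycle in a multigraph may be a loop (a cycle of length $1$), two parallel edges between the same two vertices (a cycle of length $2$), or an ordinary cycle of length at least $3$; ''disjoint'' means vertex-disjoint. For a vertex $v$, $N(v)$ is the set of vertices other than $v$ adjacent to $v$, the simple degree is $s(v)=|N(v)|$, and $\mathcal{S}(G)=\min\{s(v):v\in V(G)\}$ is the minimum simple degree. $V_1(G)$ is the set of vertices incident to loops. $F(G)$ is the simple graph formed by the multiple edges of $G-V_1$: its vertices are the vertices of $G-V_1$ incident to some multiple edge, and two such distinct vertices are adjacent in $F(G)$ iff they are joined by at least two edges in $G$. $\alpha'(F)$ is the size of a maximum matching in $F$. *)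

(* Defs.v *)
From HB Require Import structures.
From mathcomp Require Import all_boot all_order all_algebra.
Set Implicit Arguments.
Unset Strict Implicit.
Unset Printing Implicit Defensive.

(* The set of ends of an edge has one element exactly when it is a loop. *)
Record multigraph := Multigraph {
  vertex : finType;
  edge : finType;
  ends : edge -> {set vertex};
  ends_card : forall e, 0 < #|ends e| <= 2
}.

Section Multigraph.
Variable G : multigraph.
Implicit Types u v : vertex G.

(* Number of edges joining u and v; number of loops at v if u = v. *)
Definition mult u v : nat := #|[set e : edge G | ends e == [set u; v]]|.

Definition neighbors v : {set vertex G} := [set u | (u != v) && (0 < mult u v)].

Definition simple_degree v : nat := #|neighbors v|.

(* Every simple degree is less than #|vertex G|, so this is the minimum
   whenever G has a vertex; it is 0 on the null graph. *)
Definition min_simple_degree : nat :=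
  \big[minn/#|vertex G|]_(v : vertex G) simple_degree v.

Definition V1 : {set vertex G} := [set v | 0 < mult v v].

(* c = [:: (v_0, e_0); ...; (v_n-1, e_n-1)], where e_i joins v_i to v_i+1 and
   indices are modulo n.  For n = 1, e_0 is a loop at v_0; for n = 2, e_0 and
   e_1 are distinct parallel edges. *)
Definition is_cycle (c : seq (vertex G * edge G)) : bool :=
  [&& 0 < size c, uniq (unzip1 c), uniq (unzip2 c)
    & cycle (fun p q => ends p.2 == [set p.1; q.1]) c].

Definition has_disjoint_cycles (k : nat) : Prop :=
  exists C : 'I_k -> seq (vertex G * edge G),
    (forall i, is_cycle (C i)) /\
    (forall i j, i != j -> [disjoint unzip1 (C i) & unzip1 (C j)]).

End Multigraph.

Record sgraph := SGraph {
  svertex : finType;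
  sadj : rel svertex;
  sadj_sym : symmetric sadj;
  sadj_irr : irreflexive sadj
}.

Section Matching.
Variable H : sgraph.

Definition sedges : {set {set svertex H}} :=
  [set [set p.1; p.2] | p : svertex H * svertex H & sadj p.1 p.2].

Definition is_matching (M : {set {set svertex H}}) : bool :=
  (M \subset sedges) && trivIset M.

Definition matching_number : nat :=
  \max_(M : {set {set svertex H}} | is_matching M) #|M|.

End Matching.

Section MultipleEdges.
Variable G : multigraph.

Definition multi_adj : rel (vertex G) :=
  [rel u v | (u != v) && (1 < mult u v)].

Definition F_vertices : {set vertex G} :=
  [set v | (v \notin V1 G) && [exists u, (u \notin V1 G) && multi_adj u v]].

Definition F_adj : rel {v : vertex G | v \in F_vertices} :=
  [rel x y | multi_adj (val x) (val y)].

Lemma F_adj_sym : symmetric F_adj.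
Proof. by move=> x y; rewrite /F_adj /multi_adj /= eq_sym /mult setUC. Qed.

Lemma F_adj_irr : irreflexive F_adj.
Proof. by move=> x; rewrite /F_adj /multi_adj /= eqxx. Qed.

Definition F : sgraph := SGraph F_adj_sym F_adj_irr.

End MultipleEdges.

(* Main.v *)
Require Import Defs.
From HB Require Import structures.
From mathcomp Require Import all_boot all_order all_algebra.
From mathcomp Require Import zify.
From Stdlib Require Import Classical.
Set Implicit Arguments.
Unset Strict Implicit.
Unset Printing Implicit Defensive.

(* If n + 2 l + a >= 3 k, take the l loops at V1 and the a double edges of a
   maximum matching of F.  If these are fewer than k cycles, deleting their
   vertices leaves a graph with at least 3 k' vertices and minimum degree at
   least 2 k', where k' = k - l - a, so the Corradi-Hajnal theorem provides the
   remaining k' cycles.  Conversely, in a family of k disjoint cycles at most l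
   meet V1, at most a of the others have length two, and the rest have at least
   three vertices.

   For the Corradi-Hajnal theorem, adding edges yields k - 1 disjoint cycles
   missing at least three vertices.  Choose k - 1 disjoint cycles covering as few
   vertices as possible, and among such families one leaving a longest possible
   path in the (acyclic) rest R.  A vertex of R has at most three neighbours on a
   member C of the family, and three only if C is a triangle.  Counting edges
   from a few vertices of R to the members produces a triangle C with many such
   edges, where either two disjoint cycles replace C, or exchanging one vertex
   of C with a vertex of R lengthens the path.  So R consists of the path, and
   the same counting excludes paths with at least four vertices.  Finally,
   for a path y z y', some triangle A receives five edges from y and y'; then z
   has no neighbour on A, and vertices of A can be exchanged with y and y'.
   Comparing the resulting three families on the other members gives a
   contradiction. *)

(** * Extremal choices and pigeonhole *)

Lemma exists_minimal (A : Type) (P : A -> Prop) (f : A -> nat) :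
  (exists a, P a) -> exists a, P a /\ forall b, P b -> f a <= f b.
Proof.
case=> a Pa; apply: NNPP => no_min.
(* Without a minimum, every n would bound f from below on P, including n = f a + 1. *)
suff nP n b : P b -> n <= f b by have := nP (f a).+1 a Pa; rewrite ltnn.
elim: n b => // n IHn b Pb; rewrite ltn_neqAle IHn // andbT.
apply/eqP => nE; apply: no_min; exists b; split=> // c Pc.
by rewrite -nE IHn.
Qed.

Lemma exists_maximal (A : Type) (P : A -> Prop) (f : A -> nat) (N : nat) :
  (forall a, P a -> f a <= N) ->
  (exists a, P a) -> exists a, P a /\ forall b, P b -> f b <= f a.
Proof.
move=> leN /(exists_minimal (fun a => N - f a)) [a [Pa min_a]].
by exists a; split=> // b Pb; have := min_a b Pb; have := leN b Pb; lia.
Qed.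

Lemma pigeonhole_sum (I : finType) (S : {set I}) (f : I -> nat) (m : nat) :
  m * #|S| < \sum_(i in S) f i -> exists2 i, i \in S & m < f i.
Proof.
move=> lt_sum; apply/exists_inP; apply: contraLR lt_sum.
rewrite -leqNgt => /exists_inPn le_f.
rewrite mulnC -sum_nat_const; apply: leq_sum => i Si.
by rewrite leqNgt le_f.
Qed.

(** * Disjoint families of sets *)

Section Families.
Variable T : finType.
Implicit Types (F : {set {set T}}) (A B C : {set T}).

(** C' lies in C and the uncovered points, so it meets no other member; being nonempty, it also
    differs from all of them, which keeps the number of members. *)
Lemma trivIset_swap F C C' :
    trivIset F -> C \in F -> C' \subset C :|: ~: cover F -> C' != set0 ->
  [/\ trivIset (C' |: F :\ C), #|C' |: F :\ C| = #|F|
    & cover (C' |: F :\ C) = C' :|: cover F :\: C].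
Proof.
move=> tF FC sC' C'n0.
have dC' : {in F :\ C, forall B, [disjoint C' & B]}.
  move=> B /setD1P [BC FB]; rewrite (disjointWl sC') //.
  rewrite -setI_eq0 setIUl setU_eq0 !setI_eq0.
  have /trivIsetP tP := tF; rewrite tP 1?eq_sym //= disjoint_sym disjoints_subset.
  by rewrite setCK; apply: bigcup_sup.
have nF : C' \notin F :\ C.
  by apply/negP => /dC'; rewrite -setI_eq0 setIid (negbTE C'n0).
split; last by rewrite /cover bigcup_setU big_set1 -[X in _ :|: X]/(cover _) coverD1.
- apply/trivIsetP => A B /setU1P[->|FA] /setU1P[->|FB] nAB; first by rewrite eqxx in nAB.
  + exact: dC'.
  + by rewrite disjoint_sym dC'.
  + by have /trivIsetP tP := trivIsetD [set C] tF; apply: tP.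
- by rewrite cardsU1 nF (cardsD1 C F) FC.
Qed.

End Families.

(** * Degrees, paths and cycles in a simple graph *)

Section Graph.
Variables (T : finType) (e : rel T).
Hypotheses (e_sym : symmetric e) (e_irr : irreflexive e).
Implicit Types (F : {set {set T}}) (A B C R : {set T}) (u v x y z c : T) (p s : seq T).

(** The number of neighbours of v in A, written as a sum so that it splits over disjoint sets. *)
Definition deg v A := \sum_(u in A) e v u.

Lemma degE v A : deg v A = #|[set u in A | e v u]|.
Proof.
rewrite /deg (eq_bigr (fun u => if e v u then 1 else 0)) => [|u _]; last by case: (e v u).
by rewrite -big_mkcondr sum1_card; apply: eq_card => u; rewrite !inE.
Qed.

Lemma deg_cover v F : trivIset F -> deg v (cover F) = \sum_(C in F) deg v C.
Proof. exact: big_trivIset. Qed.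

Lemma deg_setC v A : deg v [set: T] = deg v A + deg v (~: A).
Proof.
rewrite /deg (bigID (mem A)) /=; congr (_ + _); apply: eq_bigl => u; rewrite !inE //=.
Qed.

Lemma deg_le_card v A : deg v A <= #|A|.
Proof. by rewrite degE; apply/subset_leq_card/subsetP => u /setIdP[]. Qed.

Lemma deg_le_size v A s : {in A, forall u, e v u -> u \in s} -> deg v A <= size s.
Proof.
move=> sA; rewrite degE; apply: leq_trans (card_size s).
by apply/subset_leq_card/subsetP => u /setIdP[]; exact: sA.
Qed.

Lemma deg_eq0 v A u : deg v A = 0 -> u \in A -> e v u = false.
Proof.
rewrite degE => /eqP; rewrite cards_eq0 => /eqP E uA; apply/negP => ev.
by have := in_set0 u; rewrite -E inE uA ev.
Qed.

Lemma deg_gt0 v A : 0 < deg v A -> exists2 u, u \in A & e v u.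
Proof. by rewrite degE => /card_gt0P[u /setIdP[]]; exists u. Qed.

Lemma deg_full v A u : #|A| <= deg v A -> u \in A -> e v u.
Proof.
rewrite degE => leA uA.
have /eqP E : [set u in A | e v u] == A.
  by rewrite eqEcard leA andbT; apply/subsetP => w /setIdP[].
by have := uA; rewrite -E inE => /andP[].
Qed.

(** c is the one vertex of A that v may miss; if v misses none, any c serves, so c may still be
    adjacent to v. *)
Lemma deg_miss v A : 0 < #|A| -> #|A| <= (deg v A).+1 ->
  exists2 c, c \in A & {in A :\ c, forall u, e v u}.
Proof.
move=> /card_gt0P[c0 c0A]; case: (boolP [forall (u | u \in A), e v u]).
  by move/forall_inP => all _; exists c0 => // u /setD1P[_]; exact: all.
rewrite negb_forall_in => /exists_inP[c cA nc].
rewrite (cardsD1 c) cA add1n ltnS => leA; exists c => // u uc.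
apply: (@deg_full v (A :\ c)) => //; apply: leq_trans leA _.
rewrite !degE; apply/subset_leq_card/subsetP => w /setIdP[wA ew].
by rewrite !inE wA ew !andbT; apply: contraNneq nc => <-.
Qed.

(** A contains a cycle but may have further vertices, which makes the notion monotone; for members
    of minimal families, minimality excludes the spare vertices. *)
Definition cyclic A :=
  exists s, [/\ uniq s, 2 < size s, cycle e s & {subset s <= A}].

Lemma cyclic_sub A B : A \subset B -> cyclic A -> cyclic B.
Proof. by move=> /subsetP sAB [s [? ? ? sA]]; exists s; split=> // x /sA/sAB. Qed.

Lemma cyclic_card A : cyclic A -> 2 < #|A|.
Proof.
case=> s [us ss _ sA]; apply: leq_trans ss _; rewrite -(card_uniqP us).
exact/subset_leq_card/subsetP.
Qed.

Lemma cyclic_neq0 A : cyclic A -> A != set0.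
Proof. by move/cyclic_card; rewrite -card_gt0; lia. Qed.

Lemma cyclic_complete C u v :
  cyclic C -> #|C| = 3 -> u \in C -> v \in C -> u != v -> e u v.
Proof.
move=> [s [us ss cs sC]] cC uC vC uv.
have sE : s =i C.
  apply/subset_cardP; last exact/subsetP.
  apply/eqP; rewrite eqn_leq; apply/andP; split; first exact/subset_leq_card/subsetP.
  by rewrite cC (card_uniqP us).
have : size s = 3 by rewrite -(card_uniqP us) (eq_card sE).
rewrite -!sE in uC vC; case: s cs {us ss sC sE} uC vC => [|a [|b [|c []]]] //=.
rewrite !inE !andbT => /and3P[ab bc ca].
move=> /or3P[]/eqP Eu /or3P[]/eqP Ev _; move: uv; rewrite Eu Ev ?eqxx // => _;
  by rewrite // e_sym.
Qed.

Definition linked x y A :=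
  exists p, [/\ path e x p, uniq (x :: p), last x p = y & {subset x :: p <= A}].

Lemma linked_refl x A : x \in A -> linked x x A.
Proof. by move=> xA; exists [::]; split=> // y; rewrite inE => /eqP->. Qed.

Lemma linked_edge x y A : x \in A -> y \in A -> e x y -> linked x y A.
Proof.
move=> xA yA xy; exists [:: y]; split; rewrite //= ?xy // ?inE ?andbT.
  by apply: contraTneq xy => ->; rewrite e_irr.
by move=> z; rewrite !inE => /orP[] /eqP->.
Qed.

Lemma linked_memr x y A : linked x y A -> y \in A.
Proof. by case=> p [_ _ <- sA]; apply/sA/mem_last. Qed.

Lemma linked_meml x y A : linked x y A -> x \in A.
Proof. by case=> p [_ _ _ sA]; apply/sA/mem_head. Qed.

Lemma linked_sym x y A : linked x y A -> linked y x A.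
Proof.
case=> p [ep up <- sA]; exists (rev (belast x p)).
have E : last x p :: rev (belast x p) = rev (x :: p) by rewrite [in RHS]lastI rev_rcons.
split; rewrite ?E ?rev_uniq //.
- by rewrite rev_path; rewrite (@eq_path _ _ e) // => a b; rewrite e_sym.
- case: p {ep up sA E} => //= a p; rewrite rev_cons last_rcons //.
- by move=> z; rewrite mem_rev => /sA.
Qed.

(** Two disjoint paths are joined end to end by two edges. The last condition excludes two single
    vertices, where one edge would be traversed twice. *)
Lemma cyclic_close2 a b c d A B :
    linked a b A -> linked c d B -> [disjoint A & B] -> e b c -> e d a ->
    (a != b) || (c != d) ->
  cyclic (A :|: B).
Proof.
move=> [p [ep up lp sA]] [q [eq uq lq sB]] dAB bc da ne.
exists ((a :: p) ++ (c :: q)); split.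
- rewrite cat_uniq up uq andbT; apply/hasPn => z /sB zB.
  by apply/negP => /sA zA; rewrite (disjointFr dAB zA) in zB.
- have : 0 < size p + size q.
    rewrite lt0n addn_eq0; apply/negP => /andP[/nilP p0 /nilP q0].
    by move: ne; rewrite -lp -lq p0 q0 /= !eqxx.
  by rewrite size_cat /=; lia.
- by rewrite /= rcons_cat cat_path /= rcons_path ep lp bc eq lq da.
- by move=> z; rewrite mem_cat => /orP[/sA|/sB] zz; rewrite inE zz ?orbT.
Qed.

Lemma cyclic_close x y c A :
  linked x y A -> c \notin A -> x != y -> e c x -> e c y -> cyclic (c |: A).
Proof.
move=> lxy cA xy cx cy; apply: (cyclic_close2 (linked_refl (set11 c)) lxy) => //.
- by rewrite disjoints1.
- by rewrite e_sym.
- by rewrite xy orbT.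
Qed.

Lemma cyclic_triangle C c x :
    cyclic C -> #|C| = 3 -> c \in C -> x \notin C -> {in C :\ c, forall u, e x u} ->
  cyclic (x |: C :\ c).
Proof.
move=> cC C3 cin xC ex.
have : 1 < #|C :\ c| by rewrite [X in 1 < X](_ : _ = 2) //; have := cardsD1 c C; rewrite cin; lia.
case/card_gt1P => u [w [uC wC uw]].
have /setD1P[_ uC'] := uC; have /setD1P[_ wC'] := wC.
apply: (@cyclic_close u w x (C :\ c)); rewrite ?ex //.
- by apply: linked_edge; rewrite ?(cyclic_complete cC C3 uC' wC').
- by rewrite !inE (negbTE xC) andbF.
Qed.

(** A neighbour of y further along the path would close a cycle with the segment up to it. For empty
    p the default of [head] is harmless, because y is not adjacent to itself. *)
Lemma chord_cyclic y p v A :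
    path e y p -> uniq (y :: p) -> {subset y :: p <= A} -> ~ cyclic A ->
  v \in y :: p -> e y v -> v = head y p.
Proof.
move=> ep up sA nA vp yv; apply/eqP/idPn => nv; apply: nA.
have: v \in p by move: vp; rewrite inE => /orP[/eqP E|//]; rewrite E e_irr in yv.
case: p ep up sA {vp} nv => //= a p; move=> /andP[ya ep] /and3P[yn an up] sA va.
rewrite inE (negbTE va) /= => vp; case/splitPr: vp ep up yn an sA => p1 p2.
rewrite cat_path /= => /and3P[ep1 lv _].
rewrite cat_uniq /= => /and4P[up1 hp vp2 _] yn an sA.
exists (y :: a :: rcons p1 v); split=> //.
- rewrite /= !inE !mem_rcons !inE rcons_uniq up1 andbT; move: yn an hp.
  rewrite !inE !mem_cat !inE !negb_or => /and4P[-> -> -> _] /and3P[-> -> _] /andP[-> _].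
  by [].
- by rewrite /= size_rcons.
- by rewrite /= ya !rcons_path last_rcons ep1 lv e_sym yv.
- move=> z zin; apply: sA; move: zin; rewrite !inE mem_rcons mem_cat !inE.
  by case: eqP => //= _; case: eqP => //= _ /orP[] ->; rewrite ?orbT.
Qed.

(** * Minimal families of disjoint cycles *)

Definition cycle_family F := trivIset F /\ forall C, C \in F -> cyclic C.

Lemma cycle_family_add F C :
    cycle_family F -> cyclic C -> C \subset ~: cover F ->
  cycle_family (C |: F) /\ #|C |: F| = #|F|.+1.
Proof.
move=> [tF cF] cC sC.
have [||tCF nC] := @trivIsetU1 _ C F _ tF; last 1 first.
- split; last by rewrite cardsU1 nC.
  by split=> // B /setU1P[->|/cF].
- move=> B FB; rewrite (disjointWl sC) // disjoint_sym disjoints_subset setCK.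
  exact: bigcup_sup.
- by apply/negP => /cF/cyclic_neq0; rewrite eqxx.
Qed.

Lemma cycle_family_swap F C C' :
    cycle_family F -> C \in F -> cyclic C' -> C' \subset C :|: ~: cover F ->
  [/\ cycle_family (C' |: F :\ C), #|C' |: F :\ C| = #|F|,
      cover (C' |: F :\ C) = C' :|: cover F :\: C
    & #|cover (C' |: F :\ C)| + #|C| = #|cover F| + #|C'|].
Proof.
move=> [tF cF] FC cC' sC'.
have [tF' cardF' covF'] := trivIset_swap tF FC sC' (cyclic_neq0 cC').
split=> //; first by split=> // B /setU1P[->//|/setD1P[_ /cF]].
rewrite covF'.
have sCF : C \subset cover F by apply: bigcup_sup.
have -> : #|cover F| = #|C| + #|cover F :\: C|.
  by rewrite -(cardsID C (cover F)) (setIidPr sCF).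
suff -> : #|C' :|: cover F :\: C| = #|C'| + #|cover F :\: C| by lia.
suff C'0 : C' :&: (cover F :\: C) = set0 by rewrite cardsU C'0 cards0 subn0.
apply/setP => u; rewrite !inE; apply/negP => /and3P[/(subsetP sC')].
by rewrite !inE => /orP[->|/negbTE->].
Qed.

Section MinimalFamily.
Variable k : nat.
Hypothesis no_larger : forall F, cycle_family F -> #|F| <> k.+1.

Definition minimal_family F :=
  [/\ cycle_family F, #|F| = k
    & forall F', cycle_family F' -> #|F'| = k -> #|cover F| <= #|cover F'|].

Section Fixed.
Variables (F : {set {set T}}) (C : {set T}).
Hypotheses (minF : minimal_family F) (FC : C \in F).
Let R := ~: cover F.

Lemma rest_acyclic A : A \subset R -> ~ cyclic A.
Proof.
move=> sA cA; have [cF Fk _] := minF.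
by have [cAF cardAF] := cycle_family_add cF cA sA; apply: (no_larger cAF); rewrite cardAF Fk.
Qed.

Lemma member_cyclic : cyclic C.
Proof. by have [[_ cF] _ _] := minF; apply: cF. Qed.

Lemma member_notin v : v \in R -> v \notin C.
Proof. by rewrite inE; apply: contra => vC; apply/bigcupP; exists C. Qed.

Lemma member_card_le A : cyclic A -> A \subset C :|: R -> #|C| <= #|A|.
Proof.
move=> cA sA; have [cF Fk leF] := minF.
have [cF' F'k _] := cycle_family_swap cF FC cA sA.
by have := leF _ cF'; rewrite F'k Fk => /(_ erefl); lia.
Qed.

Lemma minimal_family_swap A : cyclic A -> A \subset C :|: R -> #|A| = #|C| ->
  minimal_family (A |: F :\ C).
Proof.
move=> cA sA AC; have [cF Fk leF] := minF.
have [cF' F'k _ cardF'] := cycle_family_swap cF FC cA sA.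
split=> //; first by rewrite F'k.
by move=> F'' cF'' F''k; have := leF F'' cF'' F''k; lia.
Qed.

(** Replacing C by both A and B would give k + 1 members. *)
Lemma no_two_cycles A B : cyclic A -> cyclic B ->
  A \subset C :|: R -> B \subset C :|: R -> ~ [disjoint A & B].
Proof.
move=> cA cB sA sB dAB; have [cF Fk _] := minF.
have [cF' F'k covF' _] := cycle_family_swap cF FC cA sA.
have [|cF'' F''k] := cycle_family_add cF' cB.
  rewrite covF'; apply/subsetP => u uB; have := subsetP sB u uB.
  by rewrite !inE (disjointFl dAB uB) /= => /orP[->|/negbTE->]; rewrite ?andbF.
by apply: (no_larger cF''); rewrite F''k F'k Fk.
Qed.

(** If C had more than three vertices, v and a piece of C between two of its neighbours there would
    form a shorter cycle, which could replace C. *)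
Lemma deg_member3 v : v \in R -> 2 < deg v C -> #|C| = 3.
Proof.
move=> vR; rewrite degE => /card_gt2P [x [y [z []]]].
move=> [/setIdP[xC vx] /setIdP[yC vy] /setIdP[zC vz]] [xy yz zx].
have vC := member_notin vR.
have [s [us ss cs sC]] := member_cyclic.
(* The vertices of the cycle alone could replace C, so by minimality they fill C. *)
have sE : s =i C.
  apply/subset_cardP; last exact/subsetP.
  apply/eqP; rewrite eqn_leq; apply/andP; split; first exact/subset_leq_card/subsetP.
  have -> : #|s| = #|[set u in s]| by apply: eq_card => u; rewrite inE.
  apply: member_card_le; first by exists s; split=> // u us1; rewrite inE.
  by apply/subsetP => u; rewrite !inE => /sC ->.
have cC : #|C| = size s by rewrite -(card_uniqP us) (eq_card sE).
have sub3 A : A \subset C -> v |: A \subset C :|: R.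
  by move=> sA; rewrite subUset sub1set inE vR orbT subsetU ?sA.
(* The cycle is written from x on as x q1 y' q2, with the other two neighbours of v in the order in
   which they occur. *)
have core y' z' q1 q2 : uniq (x :: q1 ++ y' :: q2) -> cycle e (x :: q1 ++ y' :: q2) ->
    x :: q1 ++ y' :: q2 =i C -> size (x :: q1 ++ y' :: q2) = #|C| -> z' \in q2 ->
    e v y' -> e v z' -> #|C| = 3.
  move=> uq cq qC szq zq vy' vz'.
  have := cq; rewrite /= rcons_cat cat_path /= rcons_path => /and4P[eq1 lq1 eq2 lq2].
  move: szq; rewrite /= size_cat /= => szq.
  (* If q2 has at least two vertices, v closes the arc from x to y' into a cycle shorter than C.
     Otherwise z' is all of q2, hence adjacent to x, and v x z' is a triangle. *)
  have [/eqP z1|q2_gt1] := leqP (size q2) 1; last first.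
    have := uq; rewrite /= cat_uniq /= mem_cat inE !negb_or -!andbA.
    case/and5P=> xq1 xy' xq2 uq1 /and4P[yq1 hq1 yq2 uq2].
    have sA : [set u in x :: rcons q1 y'] \subset C.
      apply/subsetP => u; rewrite -qC !inE mem_rcons mem_cat !inE.
      by case/or3P => ->; rewrite ?orbT.
    have cA : cyclic (v |: [set u in x :: rcons q1 y']).
      apply: (@cyclic_close x y') => //.
      + exists (rcons q1 y'); rewrite rcons_path eq1 lq1 last_rcons.
        split=> //; last by move=> u uin; rewrite inE.
        by rewrite /= mem_rcons inE negb_or xy' xq1 rcons_uniq yq1 uq1.
      + by apply: contra vC; apply: (subsetP sA).
    have leA : #|[set u in x :: rcons q1 y']| <= size q1 + 2.
      by rewrite cardsE (leq_trans (card_size _)) //= size_rcons addn2.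
    have := member_card_le cA (sub3 _ sA); move: leA; rewrite cardsU1; move: szq q2_gt1; clear.
    by case: (v \notin _) => /=; lia.
  case: q2 z1 zq uq cq qC eq2 lq2 szq => [|z1 [|? ?]] //= _.
  rewrite inE => /eqP <- {z1} uq cq qC _ z'x szq.
  have z'C : z' \in C by rewrite -qC !(inE, mem_cat) eqxx !orbT.
  have xz' : x != z' by move: uq; rewrite /= mem_cat !inE !negb_or -!andbA => /and4P[].
  have sA : [set x; z'] \subset C by rewrite subUset !sub1set xC.
  have cA : cyclic (v |: [set x; z']).
    apply: (@cyclic_close x z') => //.
      by apply: linked_edge; rewrite ?inE ?eqxx ?orbT // e_sym.
    by apply: contra vC; apply: (subsetP sA).
  have := member_card_le cA (sub3 _ sA); have := cyclic_card member_cyclic.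
  rewrite cardsU1 cards2; clear.
  by case: (v \notin _) (x != z') => [] []; lia.
have [i q rs] : rot_to_spec s x by apply: rot_to; rewrite sE.
have uq : uniq (x :: q) by rewrite -rs rot_uniq.
have cq : cycle e (x :: q) by rewrite -rs rot_cycle.
have qC : x :: q =i C by move=> u; rewrite -rs mem_rot sE.
have sq : size (x :: q) = #|C| by rewrite -rs size_rot.
have yq : y \in q by have := yC; rewrite -qC inE eq_sym (negbTE xy).
have zq : z \in q by have := zC; rewrite -qC inE (negbTE zx).
case/splitPr: yq zq uq cq qC sq => q1 q2.
rewrite mem_cat inE eq_sym (negbTE yz) /= => /orP[zq1|zq2]; last first.
  by move=> ? ? ? ?; apply: (core y z q1 q2).
case/splitPr: zq1 => q3 q4; rewrite -catA cat_cons => ? ? ? ?.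
by apply: (core z y q3 (q4 ++ y :: q2)); rewrite // mem_cat inE eqxx orbT.
Qed.

Lemma deg_member_le v : v \in R -> deg v C <= 3.
Proof.
move=> vR; rewrite leqNgt; apply/negP => d3.
by have := deg_le_card v C; rewrite (deg_member3 vR (ltnW d3)) leqNgt d3.
Qed.

(** The path from y to z in A closes a cycle at c, and y' forms a triangle with the other two
    vertices of C; together they would replace C. *)
Lemma no_parallel_triangles y z y' c A :
    #|C| = 3 -> linked y z A -> y != z -> A \subset R -> y' \in R -> y' \notin A ->
    c \in C -> e y c -> e z c -> ~ {in C :\ c, forall u, e y' u}.
Proof.
move=> C3 lyz nyz sA y'R y'A cC yc zc y'C.
have cA : c \notin A by apply: contraL cC => /(subsetP sA)/member_notin.
have H1 : cyclic (c |: A) by apply: (cyclic_close lyz) => //; rewrite e_sym.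
have H2 : cyclic (y' |: C :\ c).
  by apply: cyclic_triangle => //; [exact: member_cyclic | exact: member_notin].
apply: (no_two_cycles H1 H2).
- by rewrite subUset sub1set inE cC subsetU ?sA ?orbT.
- by rewrite subUset sub1set inE y'R orbT subsetU // subD1set.
rewrite disjoint_subset; apply/subsetP => u /setU1P[->|uA].
  by rewrite !inE eqxx orbF; apply: contraL y'R => /eqP <-; rewrite inE negbK; apply/bigcupP; exists C.
rewrite !inE negb_or negb_and (member_notin (subsetP sA u uA)) orbT andbT.
by apply: contraNneq y'A => <-.
Qed.

End Fixed.
(** The two paths may meet; each only has to avoid the end of the other, so that this end stays free
    for a second cycle. *)
Definition through F y z y' := exists A A',
  [/\ linked y z A, linked z y' A', A \subset ~: cover F, A' \subset ~: cover F
    & (y' \notin A) && (y \notin A')].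

Lemma through_sym F y z y' : through F y z y' -> through F y' z y.
Proof.
case=> A [A' [lA lA' sA sA' /andP[yA yA']]]; exists A', A.
by split; rewrite ?yA ?yA' //; apply: linked_sym.
Qed.

Lemma through_rest F y z y' : through F y z y' ->
  [/\ y \in ~: cover F, z \in ~: cover F & y' \in ~: cover F].
Proof.
case=> A [A' [lA lA' sA sA' _]]; split.
- exact: (subsetP sA _ (linked_meml lA)).
- exact: (subsetP sA _ (linked_memr lA)).
- exact: (subsetP sA' _ (linked_memr lA')).
Qed.

Lemma through_no_triangle F C y z y' c :
    minimal_family F -> C \in F -> #|C| = 3 -> through F y z y' -> c \in C ->
    e y c -> e z c -> ~ {in C :\ c, forall u, e y' u}.
Proof.
move=> minF FC C3 thr; have [_ _ y'R] := through_rest thr.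
case: thr => A [A' [lA lA' sA sA' /andP[yA yA']]].
apply: (no_parallel_triangles minF FC C3 lA _ sA y'R yA).
by apply: contraNneq yA' => ->; apply: linked_meml lA'.
Qed.

(** One end is adjacent to all of C, the other to all but at most one vertex c'. Given a neighbour c
    of z on C, the path from z to the first end closes a cycle at c if c = c', and the path to the
    second end does otherwise; the remaining end forms a triangle with C minus c. *)
Lemma through_ends5 F C y z y' :
    minimal_family F -> C \in F -> through F y z y' ->
  4 < deg y C + deg y' C -> deg z C = 0.
Proof.
move=> minF FC.
have main y1 y2 : through F y1 z y2 -> 2 < deg y1 C -> 1 < deg y2 C -> deg z C = 0.
  move=> thr d1 d2; have [y1R zR y2R] := through_rest thr.
  have C3 := deg_member3 minF FC y1R d1.
  have y1C u : u \in C -> e y1 u by apply: deg_full; rewrite C3.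
  apply/eqP; rewrite -leqn0 leqNgt; apply/negP => /deg_gt0[c cC zc].
  have [||c' c'C y2C] := @deg_miss y2 C; rewrite ?C3 //.
  have [cc'|cc'] := eqVneq c c'.
    by apply: (through_no_triangle minF FC C3 thr cC (y1C _ cC) zc); rewrite cc'.
  apply: (through_no_triangle minF FC C3 (through_sym thr) cC _ zc).
    by apply: y2C; rewrite !inE cc'.
  by move=> u /setD1P[_]; apply: y1C.
move=> thr; have [yR zR y'R] := through_rest thr => d5.
have := deg_member_le minF FC yR; have := deg_member_le minF FC y'R => d' d.
have [d3|d3] := ltnP 2 (deg y C); first by apply: (main y y') => //; lia.
by apply: (main y' y); [exact: through_sym | lia | lia].
Qed.

(** If the ends sent five edges, z would send none and the total would be at most 6; so z sends 3
    and the ends exactly 4. A split into 1 + 3 is impossible: the first end and z close a cycle at a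
    common neighbour, and the other end forms a triangle with the rest of C. *)
Lemma through_seven F C y z y' :
    minimal_family F -> C \in F -> through F y z y' ->
  6 < deg y C + deg z C + deg y' C -> [/\ deg y C = 2, deg z C = 3 & deg y' C = 2].
Proof.
move=> minF FC thr; have [yR zR y'R] := through_rest thr.
have := deg_member_le minF FC yR; have := deg_member_le minF FC y'R.
have := deg_member_le minF FC zR; have := through_ends5 minF FC thr.
have main y1 y2 : through F y1 z y2 -> 0 < deg y1 C -> 2 < deg z C -> 2 < deg y2 C -> False.
  move=> thr' d1 dz d2; have [_ _ y2R] := through_rest thr'.
  have C3 := deg_member3 minF FC zR dz.
  have [c cC y1c] := deg_gt0 d1.
  apply: (through_no_triangle minF FC C3 thr' cC y1c).
    by apply: deg_full cC; rewrite C3.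
  by move=> u /setD1P[_]; apply: deg_full; rewrite C3.
have := main _ _ thr; have := main _ _ (through_sym thr); clear.
by move: (deg y C) (deg z C) (deg y' C) => a b c; split; lia.
Qed.

(* For a path y z z' ... y' with at least four vertices. *)
Lemma four_path_bound F C y z z' y' A :
    minimal_family F -> C \in F -> linked z' y' A -> A \subset ~: cover F ->
    e y z -> e z z' -> y \notin A -> z \notin A -> z' != y' -> y != z ->
    y \in ~: cover F -> z \in ~: cover F ->
  deg y C + deg z C + deg z' C + deg y' C <= 8.
Proof.
move=> minF FC lA sA yz zz' yA zA nz' nyz yR zR; rewrite leqNgt; apply/negP => d9.
have z'A := linked_meml lA; have y'A := linked_memr lA.
have z'R := subsetP sA _ z'A; have y'R := subsetP sA _ y'A.
have zA' : linked z y' (z |: A).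
  case: lA => p [ep up lp sp]; exists (z' :: p); split; rewrite //= ?zz' //.
    have zp : z \notin z' :: p by apply: contra zA => /sp.
    by rewrite zp; move: up => /= /andP[-> ->].
  by move=> u; rewrite inE => /orP[/eqP->|/sp uA]; rewrite !inE ?eqxx ?uA ?orbT.
have sub2 a b : a \in ~: cover F -> b \in ~: cover F -> [set a; b] \subset ~: cover F.
  by move=> aR bR; rewrite subUset !sub1set aR.
have szA : z |: A \subset ~: cover F by rewrite subUset sub1set zR.
have nyy' : y' != y by apply: contraNneq yA => <-.
have nyz' : z' != y by apply: contraNneq yA => <-.
have nzz' : z' != z by apply: contraNneq zA => <-.
have nzy' : y' != z by apply: contraNneq zA => <-.
(* Both z and z' lie between the ends y and y', so the bounds for three vertices apply twice. *)
have th1 : through F y z y'.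
  exists [set y; z], (z |: A); split=> //; rewrite ?sub2 //.
    by apply: linked_edge; rewrite ?inE ?eqxx ?orbT.
  by rewrite !inE !negb_or nyy' nzy' nyz yA.
have th2 : through F y z' y'.
  exists [set y; z; z'], A; split=> //; last 1 first.
  - by rewrite !inE !negb_or nyy' nzy' yA eq_sym nz'.
  - exists [:: z; z']; split; rewrite /= ?yz ?zz' //.
      by rewrite !inE !negb_or nyz ![_ == z']eq_sym nyz' nzz'.
    by move=> u; rewrite !inE orbA.
  - by rewrite subUset sub2 // sub1set.
have := through_ends5 minF FC th1; have := through_ends5 minF FC th2.
have := through_seven minF FC th1; have := through_seven minF FC th2.
have := deg_member_le minF FC yR; have := deg_member_le minF FC y'R.
have := deg_member_le minF FC zR; have := deg_member_le minF FC z'R.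
move=> dz' dz dy' dy s2 s1 e2 e1.
have C3 : #|C| = 3.
  have [/(deg_member3 minF FC zR) //|] := ltnP 2 (deg z C).
  have [/(deg_member3 minF FC z'R) //|] := ltnP 2 (deg z' C).
  move: dy dy' e1 e2 d9; clear; lia.
have cl2 a b c : e a b -> c \notin [set a; b] -> e c a -> e c b -> cyclic (c |: [set a; b]).
  move=> ab cab ca cb; apply: (@cyclic_close a b) => //.
    by apply: linked_edge; rewrite ?inE ?eqxx ?orbT.
  by apply: contraTneq ab => ->; rewrite e_irr.
have inC u := @member_notin _ _ FC u.
have notC B u : u \in C -> B \subset ~: cover F -> u \notin B.
  by move=> uC /subsetP sB; apply: contraL uC => /sB/inC.
have sC B u : u \in C -> B \subset ~: cover F -> u |: B \subset C :|: ~: cover F.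
  by move=> uC sB; rewrite subUset sub1set inE uC subsetU // sB orbT.
(* If the ends send at most 3 edges, z and z' are adjacent to all of C and some end a sends at least
   2. With c the vertex that a may miss, z z' c is a triangle, and a forms another one with C minus
   c. *)
have [dyy|dyy] := ltnP (deg y C + deg y' C) 4.
  have dz3 : 2 < deg z C by move: dyy d9 dz dz'; clear; lia.
  have dz3' : 2 < deg z' C by move: dyy d9 dz dz'; clear; lia.
  have zC u : u \in C -> e z u by apply: deg_full; rewrite C3.
  have z'C u : u \in C -> e z' u by apply: deg_full; rewrite C3.
  have core a : a \in ~: cover F -> a \notin [set z; z'] -> 1 < deg a C -> False.
    move=> aR azz' da; have [||c cC ac] := @deg_miss a C; rewrite ?C3 //.
    apply: (@no_parallel_triangles F C minF FC z z' a c [set z; z'] C3) => //.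
    - by apply: linked_edge; rewrite ?inE ?eqxx ?orbT.
    - by rewrite eq_sym.
    - exact: sub2.
    - exact: zC.
    - exact: z'C.
  have [|dy1] := ltnP 1 (deg y C).
    by apply: core => //; rewrite !inE negb_or nyz eq_sym nyz'.
  have : 1 < deg y' C by move: dyy dy1 d9 dz dz'; clear; lia.
  by apply: core => //; rewrite !inE negb_or nzy' eq_sym nz'.
(* Now the ends send 2 edges each, and one of z, z' is adjacent to all of C, the other to at least
   two vertices. This leaves room for distinct c1 and c2 such that y z c1 is a triangle and c2
   closes the path in A to a disjoint cycle. *)
have [c1 [c2 [c1C c2C c12 H]]] : exists c1 c2, [/\ c1 \in C, c2 \in C, c1 != c2 &
    [&& e y c1, e z c1, e y' c2 & e z' c2]].
  have pick a b : exists2 u, u \in C & (u != a) && (u != b).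
    suff : 0 < #|C :\: [set a; b]|.
      by case/card_gt0P => u; rewrite !inE negb_or => /andP[uab uC]; exists u.
    rewrite cardsD C3 subn_gt0; apply: leq_ltn_trans (subset_leq_card (subsetIr _ _)) _.
    by rewrite cards2; case: (a == b).
  have [dy2 dy2' dz2 dz2'] : [/\ 1 < deg y C, 1 < deg y' C, 1 < deg z C & 1 < deg z' C].
    have {}s1 : 6 < deg y C + deg z C + deg y' C -> deg y C = 2 /\ deg y' C = 2 by case/s1.
    have {}s2 : 6 < deg y C + deg z' C + deg y' C -> deg y C = 2 /\ deg y' C = 2 by case/s2.
    by move: dz' dz dy' dy s2 s1 e2 e1 dyy d9; clear; split; lia.
  have [||c cC yC] := @deg_miss y C; rewrite ?C3 //.
  have [||c' cC' yC'] := @deg_miss y' C; rewrite ?C3 //.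
  have [dz3|dz3] := ltnP 2 (deg z C).
    have [||d dC zC'] := @deg_miss z' C; rewrite ?C3 //.
    have [c2 c2C /andP[c2c' c2d]] := pick c' d.
    have [c1 c1C /andP[c1c c1c2]] := pick c c2.
    exists c1, c2; split=> //; rewrite yC ?inE ?c1c // yC' ?inE ?c2c' // zC' ?inE ?c2d //.
    by rewrite (@deg_full z C) ?C3.
  have dz3' : 2 < deg z' C.
    by move: dz' dz dy' dy e2 e1 dyy d9 dz3; clear; lia.
  have [||d dC zC'] := @deg_miss z C; rewrite ?C3 //.
  have [c1 c1C /andP[c1c c1d]] := pick c d.
  have [c2 c2C /andP[c2c' c2c1]] := pick c' c1.
  exists c1, c2; rewrite eq_sym; split=> //.
  rewrite yC ?inE ?c1c // yC' ?inE ?c2c' // zC' ?inE ?c1d //.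
  by rewrite (@deg_full z' C) ?C3.
have /and4P[yc1 zc1 y'c2 z'c2] := H.
have Cy1 : cyclic (c1 |: [set y; z]).
  by apply: cl2; rewrite ?notC ?sub2 // e_sym.
have Cy2 : cyclic (c2 |: A).
  by apply: cyclic_close lA _ nz' _ _; rewrite ?notC // e_sym.
apply: (no_two_cycles minF FC Cy1 Cy2); rewrite ?sC ?sub2 //.
rewrite disjoint_subset; apply/subsetP => u; rewrite !inE negb_or.
case/or3P => /eqP ->; rewrite ?yA ?zA ?c12 ?notC //=.
  by rewrite andbT; apply: contraNneq (notC _ _ c2C (sub2 _ _ yR zR)) => <-; rewrite !inE eqxx.
by rewrite andbT; apply: contraNneq (notC _ _ c2C (sub2 _ _ yR zR)) => <-; rewrite !inE eqxx orbT.
Qed.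

Lemma deg_lt_card v A : v \in A -> deg v A < #|A|.
Proof.
move=> vA; rewrite degE; apply/proper_card/properP; split.
  by apply/subsetP => u /setIdP[].
by exists v; rewrite // inE e_irr andbF.
Qed.

Lemma through_three F y z y' :
    e y z -> e z y' -> y != y' ->
    y \in ~: cover F -> z \in ~: cover F -> y' \in ~: cover F ->
  through F y z y'.
Proof.
move=> yz zy' nyy' yR zR y'R; exists [set y; z], [set z; y'].
have nyz : y != z by apply: contraTneq yz => ->; rewrite e_irr.
have nzy' : z != y' by apply: contraTneq zy' => ->; rewrite e_irr.
split; rewrite ?subUset ?sub1set ?yR ?zR ?y'R //.
- by apply: linked_edge; rewrite ?inE ?eqxx ?orbT.
- by apply: linked_edge; rewrite ?inE ?eqxx ?orbT.
- by rewrite !inE !negb_or nyy' nyz ![y' == _]eq_sym nyy' nzy'.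
Qed.

(** * The degree condition and a rest of three vertices *)

Hypothesis min_deg : forall v, 2 * k.+1 <= deg v [set: T].

Lemma deg_family F v : minimal_family F ->
  2 * k.+1 <= \sum_(C in F) deg v C + deg v (~: cover F).
Proof.
by case=> [[tF _] _ _]; rewrite -deg_cover // -deg_setC.
Qed.

(** The exchange produces another triangle, so the cover keeps its size and the family stays
    minimal; c and the old uncovered vertices other than w are then uncovered. *)
Lemma triangle_swap F C c w :
    minimal_family F -> C \in F -> #|C| = 3 -> c \in C -> w \in ~: cover F ->
    {in C :\ c, forall u, e w u} ->
  minimal_family ((w |: C :\ c) |: F :\ C) /\
  forall u, (u \in C) || (u \in ~: cover F) -> u != w -> (u \notin C) || (u == c) ->
    u \in ~: cover ((w |: C :\ c) |: F :\ C).
Proof.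
move=> minF FC C3 cinC wR wC; have wnC := member_notin FC wR.
have cC := member_cyclic minF FC; have cyc := cyclic_triangle cC C3 cinC wnC wC.
have sub : w |: C :\ c \subset C :|: ~: cover F.
  by rewrite subUset sub1set inE wR orbT subsetU // subD1set.
split.
  apply: (minimal_family_swap minF FC cyc sub).
  by rewrite cardsU1 !inE (negbTE wnC) andbF (cardsD1 c C) cinC.
have [cF _ _] := minF; have [_ _ -> _] := cycle_family_swap cF FC cyc sub.
move=> u uCR uw ucC; rewrite !inE (negbTE uw) /=; move: uCR ucC; rewrite inE.
by case: (u \in C) => /=; rewrite ?andbT ?andbF ?orbF ?negbK //.
Qed.

Lemma rest_not_three F y z y' :
    minimal_family F -> e y z -> e z y' -> y != y' ->
  ~ (~: cover F = [set y; z; y']).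
Proof.
move=> minF yz zy' nyy' R3.
have inR : [/\ y \in ~: cover F, z \in ~: cover F & y' \in ~: cover F].
  by rewrite R3 !inE !eqxx !orbT.
have nadj : e y y' = false.
  apply/negP => yy'; apply: (rest_acyclic minF (subxx _)); rewrite R3 -setUA.
  apply: (@cyclic_close z y'); rewrite // ?inE ?negb_or.
  - by apply: linked_edge; rewrite ?inE ?eqxx ?orbT.
  - by rewrite nyy' andbT; apply: contraTneq yz => ->; rewrite e_irr.
  - by apply: contraTneq zy' => ->; rewrite e_irr.
have degR v : {in ~: cover F, forall u, e v u ->
    u \in [seq w <- [:: y; z; y'] | e v w]}.
  by move=> u; rewrite R3 !inE mem_filter => uR ->; rewrite !inE orbA.
have degyR : deg y (~: cover F) <= 1.
  by apply: leq_trans (deg_le_size (degR y)) _; rewrite /= e_irr nadj; case: (e y z).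
have degy'R : deg y' (~: cover F) <= 1.
  apply: leq_trans (deg_le_size (degR y')) _.
  by rewrite /= e_irr e_sym nadj; case: (e y' z).
have degzR : deg z (~: cover F) <= 2.
  by apply: leq_trans (deg_le_size (degR z)) _; rewrite /= e_irr; case: (e z y) (e z y') => [] [].
(* a is the end adjacent to all of A and b the other end; y and y' can take either role. *)
have main a b A : A \in F -> e a z -> e z b -> a != b ->
    a \in ~: cover F -> z \in ~: cover F -> b \in ~: cover F ->
    deg a (~: cover F) <= 1 -> deg b (~: cover F) <= 1 ->
    {in ~: cover F, forall u, (u == a) || (u == z) || (u == b)} ->
    2 < deg a A -> 1 < deg b A -> False.
  move=> FA az zb nab aR zR bR degaR degbR Rsub da db.
  have A3 := deg_member3 minF FA aR da.
  have aA u : u \in A -> e a u by apply: deg_full; rewrite A3.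
  have thr := through_three az zb nab aR zR bR.
  have dzA : deg z A = 0 by apply: (through_ends5 minF FA thr); move: da db; clear; lia.
  have [||a3 a3A bA] := @deg_miss b A; rewrite ?A3 //.
  have [a1 /setD1P[a13 a1A]] : exists a1, a1 \in A :\ a3.
    by apply/card_gt0P; have := cardsD1 a3 A; rewrite a3A A3; clear; lia.
  have notA u : u \in ~: cover F -> u \notin A by apply: (member_notin FA).
  have neA u w : u \in A -> w \in ~: cover F -> u != w.
    by move=> uA /notA; apply: contraNneq => <-.
  (* Exchanging a3 with b leaves the path a3 a z. Exchanging a1 with a leaves the path a1 b z, since
     b misses at most a3. The three families share all members other than A. *)
  have [minF1 rest1] := triangle_swap minF FA A3 a3A bR bA.
  have aA1 : {in A :\ a1, forall u, e a u} by move=> u /setD1P[_ /aA].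
  have [minF2 rest2] := triangle_swap minF FA A3 a1A aR aA1.
  have naz : a != z by apply: contraTneq az => ->; rewrite e_irr.
  have nzb : z != b by apply: contraTneq zb => ->; rewrite e_irr.
  have thr1 : through ((b |: A :\ a3) |: F :\ A) a3 a z.
    apply: through_three; rewrite // 1?e_sym ?aA ?rest1 ?aR ?zR ?a3A ?eqxx ?orbT ?(neA a3) //.
    - by rewrite notA.
    - by rewrite notA.
  have thr2 : through ((a |: A :\ a1) |: F :\ A) a1 b z.
    apply: through_three.
    - by rewrite e_sym bA // !inE a13.
    - by rewrite e_sym.
    - exact: neA.
    - by apply: rest2; rewrite ?a1A ?eqxx ?orbT // neA.
    - by apply: rest2; rewrite ?bR ?orbT ?notA // eq_sym.
    - by apply: rest2; rewrite ?zR ?orbT ?notA // eq_sym.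
  have sumF v : 2 * k.+1 <= deg v A + \sum_(C in F :\ A) deg v C + deg v (~: cover F).
    by have := deg_family v minF; rewrite (big_setD1 A FA).
  have degR2 v w : w \in [:: a; z; b] -> e v w = false -> deg v (~: cover F) <= 2.
    move=> w_in vw; pose s := [seq u <- [:: a; z; b] | e v u].
    have sub : {in ~: cover F, forall u, e v u -> u \in s}.
      by move=> u /Rsub; rewrite mem_filter !inE orbA => uR ->.
    apply: leq_trans (deg_le_size sub) _; rewrite size_filter.
    have := count_predC (e v) [:: a; z; b].
    have : has (predC (e v)) [:: a; z; b] by apply/hasP; exists w; rewrite //= vw.
    by rewrite has_count /=; clear; lia.
  have degA v : v \in A -> deg v A <= 2 by move=> /deg_lt_card; rewrite A3.
  (* With z taken twice, the six degrees sum to at least 12k + 12. At most 10 of this goes to A,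
     where z has no neighbour, and at most 10 to the rest, which leaves more than 12 (k - 1). *)
  have [B] : exists2 B, B \in F :\ A &
      12 < deg z B + deg z B + deg a3 B + deg a1 B + deg a B + deg b B.
    apply: pigeonhole_sum; rewrite !big_split /=.
    have FAk : #|F :\ A| + 1 = k by have [_ <- _] := minF; rewrite (cardsD1 A F) FA addnC.
    have za i : i \in A -> e i z = false by move=> iA; rewrite e_sym (deg_eq0 dzA iA).
    have da3 : deg a3 (~: cover F) <= 2 by apply: (degR2 _ z); rewrite ?inE ?eqxx ?orbT ?za.
    have da1 : deg a1 (~: cover F) <= 2 by apply: (degR2 _ z); rewrite ?inE ?eqxx ?orbT ?za.
    have dz : deg z (~: cover F) <= 2 by apply: (degR2 _ z); rewrite ?inE ?eqxx ?orbT ?e_irr.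
    have := sumF z; have := sumF a3; have := sumF a1; have := sumF a; have := sumF b.
    have := degA _ a3A; have := degA _ a1A.
    have := deg_member_le minF FA aR; have := deg_member_le minF FA bR.
    move: FAk da3 da1 dz degaR degbR dzA.
    move: (\sum_(C in F :\ A) deg z C) (\sum_(C in F :\ A) deg a3 C) => Sz S3.
    move: (\sum_(C in F :\ A) deg a1 C) (\sum_(C in F :\ A) deg a C) => S1 Sa.
    move: (\sum_(C in F :\ A) deg b C) #|F :\ A| => Sb f; clear; lia.
  rewrite !inE => /andP[BA FB].
  have FB1 : B \in (b |: A :\ a3) |: F :\ A by rewrite !inE BA FB orbT.
  have FB2 : B \in (a |: A :\ a1) |: F :\ A by rewrite !inE BA FB orbT.
  have [a3R _ _] := through_rest thr1; have [a1R _ _] := through_rest thr2.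
  (* The sum consists of the totals of a3 a z and a1 b z, so one of them is 7, say with a3, a, z
     sending 2, 3, 2. As z sends edges, b sends at most 1; hence a1 sends 3 and b sends 1. But a1
     and z then send 5 together, which allows none from b. *)
  have := through_ends5 minF FB thr.
  have := through_ends5 minF1 FB1 thr1; have := through_ends5 minF2 FB2 thr2.
  have : 6 < deg a3 B + deg a B + deg z B ->
    [&& deg a3 B == 2, deg a B == 3 & deg z B == 2].
    by move=> /(through_seven minF1 FB1 thr1)[-> -> ->].
  have : 6 < deg a1 B + deg b B + deg z B ->
    [&& deg a1 B == 2, deg b B == 3 & deg z B == 2].
    by move=> /(through_seven minF2 FB2 thr2)[-> -> ->].
  have := deg_member_le minF FB aR; have := deg_member_le minF FB bR.
  have := deg_member_le minF FB zR.
  have := deg_member_le minF1 FB1 a3R; have := deg_member_le minF2 FB2 a1R.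
  move: (deg z B) (deg a3 B) (deg a1 B) (deg a B) (deg b B); clear; lia.
have [yR zR y'R] := inR.
(* Each end has at most one neighbour in the rest, so the two send at least 4k + 2 edges to the k
   members. *)
have [A FA d5] : exists2 A, A \in F & 4 < deg y A + deg y' A.
  apply: pigeonhole_sum; rewrite big_split /=.
  have [_ -> _] := minF; have := deg_family y minF; have := deg_family y' minF.
  move: degyR degy'R.
  move: (\sum_(C in F) deg y C) (\sum_(C in F) deg y' C); clear; lia.
have := deg_member_le minF FA yR; have := deg_member_le minF FA y'R => dy' dy.
have [d3|d3] := ltnP 2 (deg y A).
  apply: (main y y' A) => //; last by move: d5 dy; clear; lia.
  by move=> u; rewrite R3 !inE.
apply: (main y' y A) => //; rewrite 1?e_sym // 1?eq_sym //.
- by move=> u; rewrite R3 !inE orbC orbA orbAC.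
- by move: d5 d3; clear; lia.
- by move: d5 dy'; clear; lia.
Qed.

Lemma linked_path P u w :
  sorted e P -> uniq P -> u \in P -> w \in P -> linked u w [set x in P].
Proof.
have core p1 p3 p4 a b : sorted e (p1 ++ a :: p3 ++ b :: p4) ->
    uniq (p1 ++ a :: p3 ++ b :: p4) -> linked a b [set x in p1 ++ a :: p3 ++ b :: p4].
  move=> sP uP; exists (rcons p3 b); split.
  - move: sP; rewrite sorted_cat_cons cat_path rcons_path /=.
    by case/and4P=> _ -> -> _.
  - move: uP; rewrite cat_uniq -cat_rcons -cat_cons cat_uniq.
    by case/and3P=> _ _ /andP[].
  - by rewrite last_rcons.
  - move=> x; rewrite !(inE, mem_cat, mem_rcons).
    by case/or3P => ->; rewrite ?orbT.
move=> sP uP uin win; case/splitPr: uin win sP uP => p1 p2.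
rewrite mem_cat inE => /or3P[win|/eqP->|win] sP uP.
- case/splitPr: win sP uP => p3 p4; rewrite -catA /= => sP uP.
  by apply: linked_sym; apply: core.
- by apply: linked_refl; rewrite inE mem_cat mem_head orbT.
- by case/splitPr: win sP uP => p3 p4; apply: core.
Qed.

(* Otherwise a longest path outside P has both ends adjacent to P, or it is a
   single vertex with two neighbours on P; each yields a cycle. *)
Lemma forest_leaf R P :
    ~ cyclic R -> sorted e P -> uniq P -> {subset P <= R} ->
    (exists2 x, x \in R & x \notin P) ->
  exists x, [/\ x \in R, x \notin P & deg x R <= 1].
Proof.
move=> nR sP uP PR [x0 x0R x0P]; apply: NNPP => no_leaf.
have deg2 x : x \in R -> x \notin P -> 1 < deg x R.
  by move=> xR xP; rewrite ltnNge; apply/negP => d1; apply: no_leaf; exists x.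
pose good Q := [/\ 0 < size Q, sorted e Q, uniq Q & {subset Q <= R :\: [set x in P]}].
have [Q [goodQ maxQ]] : exists Q, good Q /\ forall Q', good Q' -> size Q' <= size Q.
  apply: (@exists_maximal _ _ _ #|T|) => [Q [_ _ uQ _]|].
    by rewrite -(card_uniqP uQ) max_card.
  by exists [:: x0]; split=> // u; rewrite !inE => /eqP->; rewrite x0P.
(* As a longest path off P cannot be extended and R is acyclic, the only neighbour of its end in R
   outside P is the next vertex. *)
have end_nbr y q : good (y :: q) -> size Q = (size q).+1 ->
    {in R, forall u, e y u -> u != head y q -> u \in P}.
  move=> [_ /= eq uq sQ] szQ u uR yu nu; apply/idPn => uP'.
  have sQR : {subset y :: q <= R} by move=> w /sQ; rewrite inE => /andP[].
  have uq' : u \in y :: q.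
    apply/idPn => uq'; have := maxQ (u :: y :: q); rewrite szQ /= ltnn => longer.
    suff /longer : good (u :: y :: q) by [].
    split=> //=; first by rewrite e_sym yu.
      by rewrite uq'.
    by move=> w; rewrite inE => /orP[/eqP->|/sQ//]; rewrite !inE uP' uR.
  by rewrite (chord_cyclic eq uq sQR nR uq' yu) eqxx in nu.
have good_rev Q' : good Q' -> good (rev Q').
  move=> [sz sQ uQ QR]; split; rewrite ?size_rev ?rev_uniq //.
    by rewrite rev_sorted; rewrite (@eq_sorted _ _ e) // => a b; rewrite e_sym.
  by move=> w; rewrite mem_rev; apply: QR.
have nbr y q : good (y :: q) -> size Q = (size q).+1 -> exists2 u, u \in P & e y u.
  move=> gq szQ; apply: NNPP => no_nbr; have := deg2 y.
  have /setDP[-> yP] : y \in R :\: [set x in P] by have [_ _ _ sR] := gq; apply: sR; rewrite mem_head.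
  rewrite inE in yP; rewrite yP => /(_ isT isT); apply/negP; rewrite -leqNgt.
  apply: (@deg_le_size _ _ [:: head y q]) => u uR yu; rewrite inE; apply/idPn => nu.
  by apply: no_nbr; exists u => //; apply: end_nbr gq szQ u uR yu nu.
have PR' : [set x in P] \subset R by apply/subsetP => u; rewrite inE; apply: PR.
case: Q goodQ maxQ end_nbr nbr => [[]//|y q] goodQ maxQ end_nbr nbr.
have [_ sQ uQ QR] := goodQ.
have QR' : [set x in y :: q] \subset R by apply/subsetP => u; rewrite inE => /QR /setDP[].
have dis : [disjoint [set x in y :: q] & [set x in P]].
  by rewrite disjoint_subset; apply/subsetP => u; rewrite inE => /QR /setDP[].
have [u uP' yu] := nbr _ _ goodQ erefl.
have [q0|q_n0] := eqVneq q [::].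
  have /setDP[yR yP] : y \in R :\: [set x in P] by apply: QR; rewrite mem_head.
  have : 1 < deg y R by apply: deg2; rewrite // inE in yP.
  rewrite degE => /card_gt1P[a [b [/setIdP[aR ya] /setIdP[bR yb] nab]]].
  have inP w : w \in R -> e y w -> w \in P.
    move=> wR yw; apply: (end_nbr _ _ goodQ erefl _ wR yw); rewrite q0 /=.
    by apply: contraTneq yw => ->; rewrite e_irr.
  apply: nR; apply: (@cyclic_sub (y |: [set x in P])); first by rewrite subUset sub1set yR.
  by apply: (@cyclic_close a b) => //; apply: linked_path => //; apply: inP.
have revE : rev (y :: q) = last y q :: rev (belast y q) by rewrite lastI rev_rcons.
have [w wP' yw] : exists2 w, w \in P & e (last y q) w.
  apply: (nbr _ (rev (belast y q))); first by rewrite -revE; apply: good_rev.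
  by rewrite size_rev size_belast.
apply: nR; apply: (@cyclic_sub ([set x in y :: q] :|: [set x in P])).
  by rewrite subUset QR' PR'.
apply: (@cyclic_close2 y (last y q) w u) => //.
- by apply: linked_path; rewrite ?mem_head ?mem_last.
- exact: linked_path.
- by rewrite e_sym.
- case: q q_n0 uQ {goodQ maxQ end_nbr nbr sQ QR QR' dis revE yw} => // a q _ /= /andP[nyq _].
  by apply/orP; left; apply: contraNneq nyq => {1}->; apply: mem_last.
Qed.

(** * Longest paths outside a minimal family *)

Definition rest_path F P :=
  [/\ 0 < size P, sorted e P, uniq P & {subset P <= ~: cover F}].

Lemma rest_path_rev F P : rest_path F P -> rest_path F (rev P).
Proof.
case=> sz sP uP PR; split; rewrite ?size_rev ?rev_uniq //.
  by rewrite rev_sorted; rewrite (@eq_sorted _ _ e) // => a b; rewrite e_sym.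
by move=> w; rewrite mem_rev; apply: PR.
Qed.

(* All minimal families cover equally many vertices, so the length of the path
   may be maximized over all of them. *)
Definition longest_path F P := [/\ minimal_family F, rest_path F P
  & forall F' P', minimal_family F' -> rest_path F' P' -> size P' <= size P].

Lemma longest_path_rev F P : longest_path F P -> longest_path F (rev P).
Proof.
case=> minF pP maxP; split; rewrite ?size_rev //; exact: rest_path_rev.
Qed.

(** A neighbour off the path would prolong it, and one on the path other than the second vertex
    would close a cycle in the rest. *)
Lemma longest_path_end F y p : longest_path F (y :: p) -> deg y (~: cover F) <= 1.
Proof.
move=> [minF [_ /= ep up PR] maxP].
apply: (@deg_le_size _ _ [:: head y p]) => u uR yu; rewrite inE; apply/eqP.
apply: (chord_cyclic ep up PR (rest_acyclic minF (subxx _)) _ yu).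
apply/idPn => nu; have := maxP F (u :: y :: p) minF; rewrite /= ltnn => longer.
suff /longer : rest_path F (u :: y :: p) by [].
split=> //=; first by rewrite e_sym yu.
  by rewrite nu.
by move=> w; rewrite inE => /orP[/eqP->|/PR].
Qed.

(** If y were adjacent to all of C, exchanging x with the vertex c that x may miss would free c to
    prolong the path at y. *)
Lemma longest_path_end_member F C x y p :
    longest_path F (y :: p) -> C \in F -> x \in ~: cover F -> x \notin y :: p ->
  1 < deg x C -> deg y C <= 2.
Proof.
move=> [minF [_ /= ep up PR] maxP] FC xR xP dx; rewrite leqNgt; apply/negP => dy.
have yR : y \in ~: cover F by apply: PR; rewrite mem_head.
have C3 := deg_member3 minF FC yR dy.
have [||c cC xC] := @deg_miss x C; rewrite ?C3 //.
have [minF' restF'] := triangle_swap minF FC C3 cC xR xC.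
have := maxP _ (c :: y :: p) minF'; rewrite /= ltnn => longer; apply: notF; apply: longer.
have cP : c \notin y :: p by apply: contraL cC => /PR; apply: member_notin.
split=> //=.
- by rewrite ep andbT e_sym (@deg_full y C) ?C3.
- by rewrite cP.
- move=> w; rewrite inE => /orP[/eqP->|wP].
    apply: restF'; rewrite ?cC ?eqxx ?orbT //.
    by apply: contraTneq cC => ->; apply: (member_notin FC xR).
  apply: restF'; rewrite ?PR ?orbT //; first by apply: contraNneq xP => <-.
  by rewrite (member_notin FC (PR _ wP)).
Qed.

(** Let y be exchanged with the vertex c of C that it may miss. If p is empty or its last vertex is
    adjacent to c, then p, c, x is a longer path. Otherwise the last vertex has a neighbour on C
    other than c, which closes the old path to a cycle, while x forms a triangle with the rest of
    C. *)
Lemma longest_path_outside F C x y p :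
    longest_path F (y :: p) -> C \in F -> x \in ~: cover F -> x \notin y :: p ->
    2 < deg x C -> 1 < deg y C -> (p != [::] -> 0 < deg (last y p) C) ->
  False.
Proof.
move=> [minF [_ /= ep up PR] maxP] FC xR xP dx dy dl.
have yR : y \in ~: cover F by apply: PR; rewrite mem_head.
have C3 := deg_member3 minF FC xR dx.
have xC u : u \in C -> e x u by apply: deg_full; rewrite C3.
have [||c cC yC] := @deg_miss y C; rewrite ?C3 //.
have [minF' restF'] := triangle_swap minF FC C3 cC yR yC.
have [/andP[p_n0 nlc]|shift] := boolP ((p != [::]) && ~~ e (last y p) c).
  have [c' c'C lc'] := deg_gt0 (dl p_n0).
  have cc' : c' != c by apply: contraNneq nlc => <-.
  have nyl : y != last y p.
    case: p p_n0 up {ep PR maxP xP dl nlc lc'} => // a q _ /= /andP[nyq _].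
    by apply: contraNneq nyq => {1}->; apply: mem_last.
  apply: (@no_parallel_triangles F C minF FC y (last y p) x c' [set u in y :: p] C3) => //.
  - by apply: linked_path; rewrite ?mem_head ?mem_last.
  - by apply/subsetP => u; rewrite inE => /PR.
  - by rewrite inE.
  - by apply: yC; rewrite !inE cc'.
  - by move=> u /setD1P[_ /xC].
have := maxP _ (rcons (rcons p c) x) minF'.
rewrite !size_rcons /= ltnn => longer; apply: notF; apply: longer.
have cP : c \notin y :: p by apply: contraL cC => /PR; apply: member_notin.
have nxc : x != c by apply: contraTneq cC => <-; apply: (member_notin FC xR).
move: cP xP up; rewrite /= !inE !negb_or => /andP[cy cp] /andP[xy xp] /andP[yp up].
split; first by rewrite !size_rcons.
- case: p ep shift {dl maxP PR up yp cp xp} => [|a q] /=.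
    by rewrite e_sym xC.
  move=> /andP[_ eq]; rewrite negbK => lc.
  by rewrite !rcons_path last_rcons eq lc e_sym xC.
- by rewrite !rcons_uniq mem_rcons inE negb_or nxc xp cp up.
- move=> w; rewrite mem_rcons in_cons mem_rcons in_cons => /or3P[/eqP->|/eqP->|wp].
  + by apply: restF'; rewrite ?xR ?orbT ?(member_notin FC xR).
  + by apply: restF'; rewrite ?cC ?eqxx ?orbT.
  + have wR : w \in ~: cover F by apply: PR; rewrite inE wp orbT.
    apply: restF'; rewrite ?wR ?orbT ?(member_notin FC wR) //.
    by apply: contraNneq yp => <-.
Qed.

Lemma longest_path_covers F P : longest_path F P -> {subset ~: cover F <= P}.
Proof.
move=> lP x0 x0R; apply/idPn => x0P; have [minF [szP sP uP PR] maxP] := lP.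
have [|x [xR xP dx]] := forest_leaf (rest_acyclic minF (subxx _)) sP uP PR.
  by exists x0.
case: P lP szP sP uP PR maxP xP {x0P} => // y p lP _ sP uP PR maxP xP.
have lPr := longest_path_rev lP.
have revE : rev (y :: p) = last y p :: rev (belast y p) by rewrite lastI rev_rcons.
rewrite revE in lPr; set q := rev (belast y p) in lPr revE.
have lastq : last (last y p) q = y.
  by rewrite /q; case: (p) => //= a r; rewrite rev_cons last_rcons.
have q0 : (q == [::]) = (p == [::]) by rewrite -!size_eq0 size_rev size_belast.
have xPr : x \notin last y p :: q by rewrite -revE mem_rev.
(* The degrees of x, taken twice, and of the two ends sum to at least 8k + 8, of which at most 4
   stays in the rest. *)
have [C FC] : exists2 C, C \in F &
    8 < deg x C + deg x C + deg y C + deg (last y p) C.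
  apply: pigeonhole_sum; rewrite !big_split /=.
  have := longest_path_end lP; have := longest_path_end lPr; have [_ -> _] := minF.
  have := deg_family x minF; have := deg_family y minF.
  have := deg_family (last y p) minF; move: dx.
  move: (\sum_(C in F) deg x C) (\sum_(C in F) deg y C).
  by move: (\sum_(C in F) deg (last y p) C); clear; lia.
have dx3 := deg_member_le minF FC xR.
have yR : y \in ~: cover F by apply: PR; rewrite mem_head.
have lR : last y p \in ~: cover F by apply: PR; rewrite mem_last.
have dy3 := deg_member_le minF FC yR; have dl3 := deg_member_le minF FC lR.
have d1 := longest_path_end_member lP FC xR xP.
have d2 := longest_path_end_member lPr FC xR xPr.
(* If x sent at most 1 edge, the sum would be at most 8. So both ends send at most 2, x sends 3, and
   one end sends at least 2, the other at least 1. *)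
move=> d9; have dx2 : 2 < deg x C by move: d9 dx3 dy3 dl3 d1 d2; clear; lia.
have [dy|dy] := ltnP 1 (deg y C).
  apply: (longest_path_outside lP FC xR xP dx2 dy) => _.
  by move: d9 dx3 dx2 d1 d2; clear; lia.
apply: (longest_path_outside lPr FC xR xPr dx2) => [|_].
  by move: d9 dx3 dx2 d1 d2 dy; clear; lia.
by rewrite lastq; move: d9 dx3 dx2 d1 d2 dy; clear; lia.
Qed.

Lemma longest_path_le2 F P : longest_path F P -> size P <= 2.
Proof.
move=> lP; rewrite leqNgt; apply/negP; have RP := longest_path_covers lP.
have [minF [_ sP uP PR] _] := lP.
case: P lP RP sP uP PR => [|y [|z [|z' p]]] // lP RP sP uP PR _.
have /and3P[yz zz' ep] := sP.
have [p0|p_n0] := eqVneq p [::].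
  rewrite p0 in lP RP uP PR; apply: (rest_not_three minF yz zz').
    by move: uP; rewrite /= !inE negb_or => /andP[/andP[]].
  apply/setP => u; apply/idP/idP => [/RP|]; rewrite !inE -orbA // => uP'.
  by have := PR u; rewrite !inE; apply.
set y' := last z' p.
have nR := rest_acyclic minF (subxx (~: cover F)).
have dy := longest_path_end lP.
have dy' : deg y' (~: cover F) <= 1.
  have := longest_path_rev lP; rewrite !rev_cons -!cats1 -!catA.
  case: (lastP p) p_n0 @y' => // p' a _ y'.
  rewrite rev_rcons /= -[X in X :: _]/a => /longest_path_end.
  by rewrite /y' last_rcons.
have subR s : {subset s <= [:: y, z, z' & p]} -> {subset s <= ~: cover F}.
  by move=> sub u /sub/PR.
move: uP; rewrite !cons_uniq => /and4P[yP zP z'p up].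
have yzz' : [&& y != z, y != z' & z != z'].
  by move: yP zP; rewrite !inE !negb_or => /and3P[-> -> _] /andP[-> _].
have /and3P[nyz nyz' nzz'] := yzz'.
have dz : deg z (~: cover F) <= 2.
  apply: (@deg_le_size _ _ [:: y; z']) => u uR zu; rewrite !inE.
  have := RP u uR; rewrite inE => /orP[->//|us].
  apply/orP; right; apply/eqP.
  apply: (@chord_cyclic z (z' :: p) u _ _ _ _ nR) => //.
  - by rewrite /= zz'.
  - by rewrite cons_uniq zP /= z'p.
  - by apply: subR => w ws; rewrite inE ws orbT.
have dz' : deg z' (~: cover F) <= 2.
  apply: (@deg_le_size _ _ [:: z; head z' p]) => u uR z'u; rewrite !inE.
  have [up'|up'] := boolP (u \in z' :: p).
    apply/orP; right; apply/eqP.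
    apply: (chord_cyclic ep _ _ nR up' z'u); first by rewrite /= z'p.
    by apply: subR => w ws; rewrite !inE in ws *; rewrite ws !orbT.
  apply/orP; left; apply/eqP.
  apply: (@chord_cyclic z' [:: z; y] u _ _ _ _ nR) => //.
  - by rewrite /= e_sym zz' e_sym yz.
  - by rewrite /= !inE negb_or ![z' == _]eq_sym nzz' nyz' eq_sym nyz.
  - by apply: subR => w; rewrite !inE => /or3P[] ->; rewrite ?orbT.
  - have := RP u uR; rewrite !inE in up' *; rewrite (negbTE up') orbF.
    by case/orP => ->; rewrite ?orbT.
(* The four vertices have degree at most 6 in total within the rest, so they send at least 8k + 2
   edges to the members. *)
have [C FC] : exists2 C, C \in F & 8 < deg y C + deg z C + deg z' C + deg y' C.
  apply: pigeonhole_sum; rewrite !big_split /=; have [_ -> _] := minF.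
  have := deg_family y minF; have := deg_family z minF.
  have := deg_family z' minF; have := deg_family y' minF.
  move: dy dz dz' dy'.
  move: (\sum_(C in F) deg y C) (\sum_(C in F) deg z C).
  by move: (\sum_(C in F) deg z' C) (\sum_(C in F) deg y' C); clear; lia.
apply/negP; rewrite -leqNgt.
apply: (@four_path_bound F C y z z' y' [set u in z' :: p]) => //.
- exists p; split=> //; first by rewrite /= z'p.
  by move=> u us; rewrite inE.
- by apply/subsetP => u; rewrite inE => us; apply: PR; rewrite 2!inE us !orbT.
- by rewrite inE; apply: contra yP => us; rewrite inE us orbT.
- by rewrite inE.
- rewrite /y'; case: p p_n0 z'p {ep lP RP sP PR yP zP up subR y' dy' dz dz'} => // a q _ z'p /=.
  by apply: contraNneq z'p => {1}->; apply: mem_last.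
- by apply: PR; rewrite mem_head.
- by apply: PR; rewrite !inE eqxx orbT.
Qed.

(** A minimal family with the longest path overall leaves at most two vertices, and all minimal
    families cover equally many. *)
Lemma minimal_family_rest F : minimal_family F -> #|~: cover F| <= 2.
Proof.
move=> minF; rewrite leqNgt; apply/negP => R3.
have [v vR] : exists v, v \in ~: cover F by apply/card_gt0P; apply: leq_trans R3.
have [[F' P'] [[minF' pP'] maxP']] : exists FP, (minimal_family FP.1 /\ rest_path FP.1 FP.2) /\
    forall FP', minimal_family FP'.1 /\ rest_path FP'.1 FP'.2 -> size FP'.2 <= size FP.2.
  apply: (@exists_maximal _ _ _ #|T|) => [[F1 P1] [_ [_ _ uP _]]|].
    by rewrite -(card_uniqP uP) max_card.
  by exists (F, [:: v]); split=> //; split=> // u; rewrite inE => /eqP->.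
have lP : longest_path F' P' by split=> // F1 P1 m1 p1; apply: (maxP' (F1, P1)).
have := longest_path_le2 lP; have := longest_path_covers lP => /= RP.
have [_ _ uP _] := pP'.
have : #|~: cover F'| <= size P'.
  by rewrite -(card_uniqP uP); apply/subset_leq_card/subsetP => u /RP.
have [_ _ minFF'] := minF; have [cF' F'k minFF] := minF'; have [cF Fk _] := minF.
have := minFF' _ cF' F'k; have := minFF _ cF Fk.
have := cardsC (cover F); have := cardsC (cover F'); move: R3.
clear => /=; lia.
Qed.

End MinimalFamily.

(** * The Corradi-Hajnal theorem *)

Lemma cycle_family_extend k F0 :
    (forall v, 2 * k.+1 <= deg v [set: T]) -> cycle_family F0 -> #|F0| = k ->
    #|cover F0| + 3 <= #|T| ->
  exists F, cycle_family F /\ #|F| = k.+1.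
Proof.
move=> min_deg cF0 F0k room; apply: NNPP => no_larger.
have {}no_larger F : cycle_family F -> #|F| <> k.+1.
  by move=> cF Fk; apply: no_larger; exists F.
have [|F [[cF Fk] minF]] := @exists_minimal _ (fun F => cycle_family F /\ #|F| = k)
  (fun F => #|cover F|); first by exists F0.
have mF : minimal_family k F by split=> // F' cF' F'k; apply: minF.
have := minimal_family_rest no_larger min_deg mF; have := cardsC (cover F).
have := minF F0 (conj cF0 F0k); move: room; clear; lia.
Qed.

Lemma complete_cycle_family k :
    (forall u v, u != v -> e u v) -> 3 * k <= #|T| ->
  exists F, [/\ cycle_family F, #|F| = k & #|cover F| <= 3 * k].
Proof.
move=> full; elim: k => [|k IHk] k3.
  exists set0; rewrite cards0 /cover big_set0 cards0; split=> //; split=> [|C].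
    by apply/trivIsetP => A B; rewrite inE.
  by rewrite inE.
have [|F [cF Fk covF]] := IHk; first by move: k3; clear; lia.
have : 3 <= #|~: cover F|.
  by have := cardsC (cover F); move: covF k3; clear; lia.
case/card_geqP => s [us s3 sF]; pose C := [set x in s].
have cC : cyclic C.
  exists s; split; rewrite ?s3 //; last by move=> x xs; rewrite inE.
  case: s us s3 sF @C => [|a [|b [|c []]]] //=; rewrite !inE !andbT negb_or.
  by case/andP=> /andP[ab ac] bc _ _; rewrite !full // eq_sym.
have [|cCF CFk] := cycle_family_add cF cC.
  by apply/subsetP => x; rewrite inE => /sF.
exists (C |: F); split; rewrite ?CFk ?Fk //.
rewrite /cover bigcup_setU big_set1 cardsU.
have : #|C| <= 3 by rewrite cardsE -s3 card_size.
by move: covF; rewrite /cover; clear; lia.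
Qed.

End Graph.

(* Induction on the number of non-adjacent pairs: the cycle using an added edge
   has at least three vertices, which the other k - 1 cycles leave free. *)
Theorem corradi_hajnal (T : finType) (e : rel T) (k : nat) :
    symmetric e -> irreflexive e -> 3 * k <= #|T| ->
    (forall v, 2 * k <= deg e v [set: T]) ->
  exists F, cycle_family e F /\ #|F| = k.
Proof.
move=> e_sym e_irr k3 min_deg.
pose missing (r : rel T) := [set p : T * T | (p.1 != p.2) && ~~ r p.1 p.2].
have [m] := ubnP #|missing e|; elim: m e e_sym e_irr min_deg => // m IHm e e_sym e_irr min_deg lem.
have [/set0Pn[[u v]]|full] := boolP (missing e != set0); last first.
  have [|F [cF Fk _]] := @complete_cycle_family T e k _ k3; last by exists F.
  move=> u v uv; apply/idPn => nuv; move: full; rewrite negbK => /eqP/setP/(_ (u, v)).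
  by rewrite !inE /= uv nuv.
rewrite inE /= => /andP[uv nuv].
pose e' := [rel a b | e a b || ((a == u) && (b == v) || (a == v) && (b == u))].
have sub_e a b : e a b -> e' a b by rewrite /= => ->.
have [||||F [[tF cF] Fk]] := IHm e'.
- by move=> a b; rewrite /= e_sym; congr (_ || _); rewrite orbC ![(b == _) && _]andbC.
- move=> a; rewrite /= e_irr /=; apply/negP => /orP[] /andP[/eqP-> /eqP E];
    by rewrite E eqxx in uv.
- move=> w; apply: leq_trans (min_deg w) _; apply: leq_sum => a _.
  by have := sub_e w a; case: (e w a) => // /(_ isT) H; rewrite lt0b; exact: H.
- rewrite -ltnS; apply: leq_trans lem; rewrite ltnS; apply/proper_card/properP; split.
    apply/subsetP => -[a b]; rewrite !inE /= => /andP[-> /norP[-> _]] //.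
  by exists (u, v); rewrite !inE /= ?uv ?nuv // !eqxx orbT.
have avoid C : cyclic e' C -> u \notin C -> cyclic e C.
  move=> [s [us ss cs sC]] uC; exists s; split=> //.
  have us' : u \notin s by apply: contra uC; apply: sC.
  apply: (@sub_in_cycle _ (mem s) e') cs; last by apply/allP.
  move=> a b /= as' bs' /orP[//|/orP[] /andP[/eqP E1 /eqP E2]].
    by rewrite -E1 as' in us'.
  by rewrite -E2 bs' in us'.
have [allF|] := classic (forall C, C \in F -> cyclic e C); first by exists F.
(* Some member C is cyclic only with the added edge. It contains u, so the other members avoid u and
   contain cycles of the original graph. *)
move=> /not_all_ex_not[C /(imply_to_and (C \in F))[FC nC]].
have uC : u \in C by apply/idPn => uC; apply/nC/avoid => //; apply: cF.
have CF : cycle_family e (F :\ C).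
  split; first exact: trivIsetD.
  move=> B /setD1P[BC FB]; apply: avoid; first exact: cF.
  apply/negP => uB; have /trivIsetP/(_ B C FB FC BC) := tF.
  by move/disjointFr => /(_ u uB); rewrite uC.
have kE : #|F :\ C|.+1 = k by rewrite -Fk (cardsD1 C F) FC.
have min_deg' v' : 2 * #|F :\ C|.+1 <= deg e v' [set: T] by rewrite kE.
have [|F' [cF' F'k]] := cycle_family_extend e_sym e_irr min_deg' CF erefl; last first.
  by exists F'; rewrite F'k kE.
rewrite coverD1 //.
have := cyclic_card (cF C FC).
have : #|cover F| <= #|T| by apply: max_card.
have sC : C \subset cover F by apply: bigcup_sup.
by rewrite cardsD (setIidPr sC); have := subset_leq_card sC; clear; lia.
Qed.

(** * Multigraphs *)

Section Multigraph.
Variable G : multigraph.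
Implicit Types (u v w : vertex G) (A B : {set vertex G}).

Definition adj : rel (vertex G) := [rel u v | (u != v) && (0 < mult u v)].

Lemma adj_sym : symmetric adj.
Proof. by move=> u v; rewrite /adj /= eq_sym /mult setUC. Qed.

Lemma adj_irr : irreflexive adj.
Proof. by move=> u; rewrite /adj /= eqxx. Qed.

Definition contains_cycle A :=
  exists c : seq (vertex G * edge G), is_cycle c && ([set v in unzip1 c] \subset A).

Lemma contains_cycle_neq0 A : contains_cycle A -> A != set0.
Proof.
case=> -[|[v e] c] /andP[//]; rewrite /is_cycle /= => _ /subsetP sA.
by apply/set0Pn; exists v; apply: sA; rewrite !inE eqxx.
Qed.

Lemma contains_cycle_loop v : v \in V1 G -> contains_cycle [set v].
Proof.
rewrite inE => /card_gt0P[e]; rewrite inE => ends_e; exists [:: (v, e)].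
rewrite /is_cycle /= ends_e; apply/subsetP => u; rewrite !inE //.
Qed.

Lemma contains_cycle_double u v : multi_adj u v -> contains_cycle [set u; v].
Proof.
case/andP=> uv /card_gt1P[e1 [e2 []]]; rewrite !inE => e1P e2P e12.
exists [:: (u, e1); (v, e2)]; rewrite /is_cycle /= !inE uv e12 e1P setUC e2P /=.
by apply/subsetP => w; rewrite !inE orbC.
Qed.

(** One edge is chosen for every step of the cycle. Two steps sharing an edge would go from v to w
    and back, which is impossible on a cycle with at least three vertices. *)
Lemma contains_cycle_adj A : cyclic adj A -> contains_cycle A.
Proof.
case=> s [us ss cs sA].
have next_adj v : v \in s -> adj v (next s v) by apply: next_cycle.
have [e0 _] : exists e0 : edge G, true.
  case: s ss next_adj {us cs sA} => // v s _ /(_ v (mem_head _ _)) /andP[_ /card_gt0P[e _]].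
  by exists e.
(* The choice needs a default edge; on the cycle a suitable edge always exists. *)
pose f v := odflt e0 [pick e | ends e == [set v; next s v]].
have fP v : v \in s -> ends (f v) = [set v; next s v].
  move=> /next_adj /andP[_ /card_gt0P[e]]; rewrite inE => eE.
  by rewrite /f; case: pickP => [e' /eqP//|/(_ e)]; rewrite eE.
have unz1 : unzip1 [seq (v, f v) | v <- s] = s by rewrite /unzip1 -map_comp map_id.
exists [seq (v, f v) | v <- s]; apply/andP; split; last first.
  by rewrite unz1; apply/subsetP => v; rewrite inE => /sA.
rewrite /is_cycle size_map unz1 us (ltnW (ltnW ss)) /=; apply/andP; split.
  rewrite /unzip2 -map_comp map_inj_in_uniq // => v w vs ws /= fvw.
  apply/eqP/idPn => nvw.
  have: [set v; next s v] = [set w; next s w] by rewrite -!fP // fvw.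
  move=> /setP E; have := E v; have := E w.
  rewrite !inE !eqxx /= [w == v]eq_sym (negbTE nvw) /= => /eqP wE /esym/eqP vE.
  have nn : next s (next s v) = v by rewrite -wE -vE.
  have [i q rs] := rot_to vs; have ur : uniq (v :: q) by rewrite -rs rot_uniq.
  have szq : size (v :: q) = size s by rewrite -rs size_rot.
  rewrite -!(next_rot i us) rs in nn.
  case: q {rs} ur szq nn => [|a [|b q]] /=; try by move=> _ szs; rewrite -szs in ss.
  rewrite !inE !negb_or -!andbA eqxx => /and4P[va vb _ /andP[ab _]] _.
  by rewrite eq_sym (negbTE va) eqxx => bv; rewrite bv eqxx in vb.
rewrite cycle_map; apply: cycle_from_next => // v vs.
by rewrite /= fP.
Qed.

(** * Packings of disjoint cycles *)

Definition packing (D : {set {set vertex G}}) :=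
  trivIset D /\ forall B, B \in D -> contains_cycle B.

Lemma packingU D D' : packing D -> packing D' -> [disjoint cover D & cover D'] ->
  packing (D :|: D') /\ #|D :|: D'| = #|D| + #|D'|.
Proof.
move=> [tD cD] [tD' cD'] dis; split.
  by split; [apply: trivIsetU | move=> B /setUP[/cD|/cD']].
rewrite cardsU; suff -> : D :&: D' = set0 by rewrite cards0 subn0.
apply/setP => B; rewrite !inE; apply/negP => /andP[BD BD'].
have /set0Pn[v vB] := contains_cycle_neq0 (cD B BD).
have vD : v \in cover D by apply/bigcupP; exists B.
have vD' : v \in cover D' by apply/bigcupP; exists B.
by rewrite (disjointFr dis vD) in vD'.
Qed.

Lemma packing_disjoint_cycles D k :
  packing D -> k <= #|D| -> has_disjoint_cycles G k.
Proof.
move=> [tD cD] kD.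
have mD (i : 'I_k) : enum_val (widen_ord kD i) \in D by apply: enum_valP.
have /fin_all_exists[C CP] (i : 'I_k) : exists c : seq (vertex G * edge G),
    is_cycle c && ([set v in unzip1 c] \subset enum_val (widen_ord kD i)).
  exact: cD.
exists C; split=> [i|i j ij]; first by case/andP: (CP i).
have /andP[_ /subsetP si] := CP i; have /andP[_ /subsetP sj] := CP j.
have dis : [disjoint enum_val (widen_ord kD i) & enum_val (widen_ord kD j)].
  have /trivIsetP tP := tD; apply: tP => //.
  by apply: contraNneq ij => /enum_val_inj/(congr1 val) /= ij; apply/eqP/val_inj.
rewrite disjoint_subset; apply/subsetP => v vi; rewrite inE; apply/negP => vj.
have /(disjointFr dis) : v \in enum_val (widen_ord kD i) by apply: si; rewrite inE.
by rewrite sj ?inE.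
Qed.

Lemma packing_V1 : packing [set [set v] | v in V1 G] /\
  (cover [set [set v] | v in V1 G] = V1 G /\ #|[set [set v] | v in V1 G]| = #|V1 G|).
Proof.
split; [split|split].
- apply/trivIsetP => _ _ /imsetP[u _ ->] /imsetP[v _ ->] uv.
  by rewrite disjoints1 inE; apply: contraNneq uv => ->.
- by move=> _ /imsetP[v vV ->]; apply: contains_cycle_loop.
- by rewrite cover_imset; apply/setP => v; apply/bigcupP/idP => [[u uV]|vV];
    [move=> /set1P-> | exists v; rewrite ?set11].
- by rewrite card_imset //; apply: set1_inj.
Qed.

(** The vertices of [F G] form a subtype, so a maximum matching is carried to G along [val]; each of
    its pairs is joined by multiple edges and avoids V1 by the definition of [F_vertices]. *)
Lemma packing_matching : exists D, [/\ packing D, #|D| = matching_number (F G),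
  #|cover D| = 2 * #|D| & [disjoint V1 G & cover D]].
Proof.
have [|M mM aM] := @eq_bigmax_cond _ (@is_matching (F G)) (fun M => #|M|).
  apply/card_gt0P; exists set0; rewrite /in_mem /= /is_matching sub0set.
  by apply/trivIsetP => A B; rewrite inE.
have /andP[/subsetP sM tM] : is_matching M := mM.
pose D := [set val @: (B : {set svertex (F G)}) | B in M].
have DP B : B \in D -> exists u v, [/\ B = [set u; v], multi_adj u v,
    u \notin V1 G & v \notin V1 G].
  case/imsetP=> B' /sM /imsetP[[x y]]; rewrite inE /= => xy -> ->.
  exists (val x), (val y); split=> //; first by rewrite imsetU !imset_set1.
    by have := valP x; rewrite inE => /andP[].
  by have := valP y; rewrite inE => /andP[].
have tD : trivIset D by rewrite imset_trivIset //; apply: val_inj.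
have aD : #|D| = matching_number (F G).
  by rewrite card_imset; [exact: (esym aM) | exact/imset_inj/val_inj].
move: D DP tD aD => D DP tD aD; exists D; split=> //.
- by split=> // B /DP[u [v [-> uv _ _]]]; apply: contains_cycle_double.
- have /eqP <- := tD; rewrite (eq_bigr (fun=> 2)); first by rewrite sum_nat_const mulnC.
  by move=> B /DP[u [v [-> /andP[uv _] _ _]]]; rewrite cards2 uv.
- rewrite disjoint_sym disjoint_subset; apply/subsetP => w /bigcupP[B /DP[u [v [-> _ uV vV]]]].
  by move=> /set2P wuv; rewrite inE; case: wuv => ->.
Qed.


(** * Enough vertices yield k disjoint cycles *)

Lemma min_simple_degreeP m v : m <= min_simple_degree G -> m <= simple_degree v.
Proof.
move/leq_trans; apply; rewrite /min_simple_degree.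
elim: (index_enum _) (mem_index_enum v) => // u r IHr; rewrite inE big_cons.
case/orP=> [/eqP->|/IHr]; first exact: geq_minl.
by apply: leq_trans; apply: geq_minr.
Qed.

(** Corradi-Hajnal applies to the simple graph on the complement of W, where a vertex loses at most
    [#|W|] neighbours. *)
Lemma packing_outside (W : {set vertex G}) k :
    3 * k <= #|~: W| -> (forall v, 2 * k + #|W| <= simple_degree v) ->
  exists D, [/\ packing D, #|D| = k & cover D \subset ~: W].
Proof.
move=> k3 dW; pose T := {v : vertex G | v \in ~: W}.
pose e : rel T := relpre val adj.
have [||||F [[tF cF] Fk]] := @corradi_hajnal T e k.
- by move=> x y; apply: adj_sym.
- by move=> x; apply: adj_irr.
- by rewrite card_sig (eq_card (B := mem (~: W))).
- move=> x; have inj : injective (val : T -> vertex G) by apply: val_inj.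
  rewrite degE -(card_imset _ inj).
  rewrite -(leq_add2r #|W|); apply: leq_trans (dW (val x)) _.
  apply: leq_trans (leq_card_setU _ _); apply/subset_leq_card/subsetP => u.
  rewrite inE => ux; apply/setUP; have [uW|uW] := boolP (u \in W); first by right.
  have uT : u \in ~: W by rewrite inE.
  left; apply/imsetP; exists (exist _ u uT) => //.
  by rewrite !inE /e /= adj_sym.
exists [set val @: (C : {set T}) | C in F]; split.
- split; first by rewrite imset_trivIset //; apply: val_inj.
  move=> _ /imsetP[C /cF [s [us ss cs sC]] ->]; apply: contains_cycle_adj.
  exists (map val s); split; rewrite ?size_map ?(map_inj_uniq val_inj) ?cycle_map //.
  by move=> _ /mapP[x /sC xC ->]; apply: imset_f.
- by rewrite card_imset //; apply/imset_inj/val_inj.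
- apply/subsetP => v /bigcupP[_ /imsetP[C _ ->] /imsetP[x _ ->]]; exact: valP.
Qed.

Lemma has_disjoint_cycles_suff k :
    2 * k <= min_simple_degree G ->
    3 * k <= #|vertex G| + 2 * #|V1 G| + matching_number (F G) ->
  has_disjoint_cycles G k.
Proof.
move=> hS hn; have [pL [cL aL]] := packing_V1.
have [M [pM aM cM dM]] := packing_matching.
have [|pLM aLM] := packingU pL pM; first by rewrite cL.
set LM := _ :|: M in pLM aLM.
have [kLM|LMk] := leqP k #|LM|; first exact: packing_disjoint_cycles kLM.
have cLM : cover LM = V1 G :|: cover M by rewrite /cover bigcup_setU -/(cover _) cL.
have sLM : #|cover LM| = #|V1 G| + 2 * #|M|.
  by rewrite cLM cardsU (disjoint_setI0 dM) cards0 subn0 cM.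
(* The l loops and a double edges cover l + 2a vertices. So at least 3 (k - l - a) vertices remain,
   and 2 (k - l - a) + l + 2a = 2k - l is at most 2k. *)
have [||D [pD Dk cD]] := @packing_outside (cover LM) (k - #|LM|).
- by have := cardsC (cover LM); move: hn sLM aLM LMk; rewrite -aM aL; clear; lia.
- move=> v; have := min_simple_degreeP v hS; move: sLM aLM LMk; rewrite aL; clear; lia.
have [|pU aU] := packingU pLM pD.
  by rewrite disjoint_sym disjoints_subset.
by apply: packing_disjoint_cycles pU _; rewrite aU Dk; move: LMk; clear; lia.
Qed.

(** * Vertices needed by k disjoint cycles *)

Lemma disjoint_cycles_bound k : has_disjoint_cycles G k ->
  3 * k <= #|vertex G| + 2 * #|V1 G| + matching_number (F G).
Proof.
case=> C [cycC disC]; pose D i := [set v in unzip1 (C i)].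
have disD i j : i != j -> [disjoint D i & D j].
  move=> /disC; rewrite !disjoint_subset => /subsetP ij; apply/subsetP => v.
  by rewrite !inE => /ij; rewrite !inE.
have cardD i : #|D i| = size (C i).
  have /and4P[_ u1 _ _] := cycC i.
  by rewrite cardsE (card_uniqP u1) size_map.
have D_gt0 i : 0 < #|D i| by rewrite cardD; have /and4P[] := cycC i.
(* By disjointness, a vertex of B is counted for at most one i. *)
have sum_le (B : {set vertex G}) : \sum_i #|D i :&: B| <= #|B|.
  rewrite (eq_bigr (fun i => \sum_(v in B) (v \in D i))) => [|i _]; last first.
    rewrite -sum1_card [RHS](eq_bigr (fun v => if v \in D i then 1 else 0)) => [|v _].
      by rewrite -big_mkcondr; apply: eq_bigl => v; rewrite in_setI andbC.
    by case: (v \in D i).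
  rewrite exchange_big -sum1_card; apply: leq_sum => v _.
  have [[i vi]|no_i] := classic (exists i, v \in D i); last first.
    rewrite big1 // => i _; case vi: (v \in D i) => //.
    by case: no_i; exists i.
  rewrite (bigD1 i) //= vi big1 ?addn0 // => j ji.
  by rewrite (disjointFl (disD _ _ ji) vi).
pose I1 := [set i | D i :&: V1 G != set0].
pose I2 := [set i | (D i :&: V1 G == set0) && (#|D i| == 2)].
have leI1 : #|I1| <= #|V1 G|.
  apply: leq_trans (sum_le (V1 G)); rewrite -sum1_card.
  rewrite [X in _ <= X](bigID (mem I1)) /= -[X in X <= _]addn0 leq_add //.
  by apply: leq_sum => i; rewrite inE card_gt0.
have I2P i : i \in I2 -> exists u v, [/\ D i = [set u; v], multi_adj u v,
    u \notin V1 G & v \notin V1 G].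
  rewrite inE => /andP[/eqP DV]; have := cycC i; rewrite cardD.
  have sD v : v \in D i -> v \notin V1 G.
    by move=> vD; apply/negP => vV; have := in_set0 v; rewrite -DV inE vD vV.
  move: sD; rewrite /D; case: (C i) => [|[u e1] [|[v e2] []]] // sD.
  rewrite /is_cycle /= !inE !andbT => /and4P[uv e12 ends1 ends2] _.
  exists u, v; split; try by apply: sD; rewrite !inE eqxx ?orbT.
    by apply/setP => w; rewrite !inE.
  rewrite /multi_adj /= uv; apply/card_gt1P; exists e1, e2.
  by rewrite !inE ends1 setUC ends2.
(* Pulled back to the vertices of F, the vertex sets of these cycles are disjoint and nonempty,
   hence distinct edges of a matching. *)
have leI2 : #|I2| <= matching_number (F G).
  pose N i : {set svertex (F G)} := [set x | val x \in D i].
  have inN i x : (x \in N i) = (val x \in D i) by rewrite in_set.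
  have NP i : i \in I2 -> exists x y, N i = [set x; y] /\ multi_adj (val x) (val y).
    move=> /I2P[u [v [DE uv uV vV]]].
    have vu : multi_adj v u by move: uv; rewrite /multi_adj /= eq_sym /mult setUC.
    have uF : u \in F_vertices G.
      rewrite inE uV; apply/existsP; exists v; by rewrite vV.
    have vF : v \in F_vertices G.
      by rewrite inE vV; apply/existsP; exists u; rewrite uV.
    exists (exist _ u uF), (exist _ v vF); split=> //.
    by apply/setP => x; rewrite inE DE !inE -!val_eqE.
  have disN i j : i != j -> [disjoint N i & N j].
    move=> /disD dij; rewrite disjoint_subset; apply/subsetP => x.
    rewrite inN => xi; rewrite inE inN; exact/negbT/(disjointFr dij).
  have injN : {in I2 &, injective N}.
    move=> i j iI jI Nij; apply/eqP/idPn => /disN; rewrite Nij -setI_eq0 setIid.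
    by have [x [y [-> _]]] := NP j jI; apply/negP/set0Pn; exists x; rewrite !inE eqxx.
  rewrite -(card_in_imset injN); apply: leq_bigmax_cond; apply/andP; split.
    apply/subsetP => _ /imsetP[i iI ->]; have [x [y [-> xy]]] := NP i iI.
    by apply/imsetP; exists (x, y); rewrite ?inE.
  apply/trivIsetP => _ _ /imsetP[i _ ->] /imsetP[j _ ->] nij.
  by apply: disN; apply: contraNneq nij => ->.
(* A cycle of length 1 is a loop, which meets V1 and gains 2; one of length 2 gains 2 if it meets V1
   and 1 otherwise. Summing over i gives 3k <= n + 2l + a. *)
have each i : 3 <= #|D i| + (i \in I1) + (i \in I1) + (i \in I2).
  have := D_gt0 i; case i1: (i \in I1); first by clear; lia.
  move: i1; rewrite !inE; case: eqP => // DV _ D0 /=.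
  have [/eqP D1|nD1] := eqVneq (#|D i|) 1; last by move: D0 nD1; clear; case: eqP; lia.
  exfalso; move: D1 DV; rewrite cardD /D; have := cycC i.
  case: (C i) => [|[v ed] []] //; rewrite /is_cycle /= andbT => ed_v _ /setP/(_ v).
  rewrite !inE eqxx /= => /negP[]; apply/card_gt0P; exists ed.
  by rewrite inE (eqP ed_v).
have : \sum_(i < k) 3 <= \sum_(i < k) (#|D i| + (i \in I1) + (i \in I1) + (i \in I2)).
  by apply: leq_sum => i _; apply: each.
have sum_I (I : {set 'I_k}) : \sum_(i < k) (i \in I) = #|I|.
  rewrite -sum1_card [RHS]big_mkcond; apply: eq_bigr => i _; by case: (i \in I).
rewrite sum_nat_const card_ord !big_split /= !sum_I.
have sumD : \sum_(i < k) #|D i| <= #|vertex G|.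
  by rewrite -cardsT; apply: leq_trans (sum_le setT); apply: leq_sum => i _; rewrite setIT.
move=> le_sum; rewrite mulnC mul2n -addnn !addnA; apply: leq_trans le_sum _.
by rewrite !leq_add.
Qed.

End Multigraph.

Theorem theorem2p1 (k : nat) (hk : 0 < k) (G : multigraph)
    (hS : 2 * k <= min_simple_degree G) :
  let n := #|vertex G| in
  let l := #|V1 G| in
  let a := matching_number (F G) in
  (~ has_disjoint_cycles G k <->
     (n%:Z - l%:Z - 2 * a%:Z < 3 * (k%:Z - l%:Z - a%:Z))%R) /\
  (~ has_disjoint_cycles G k <-> n + 2 * l + a < 3 * k).
Proof.
move=> n l a.
have main : ~ has_disjoint_cycles G k <-> n + 2 * l + a < 3 * k.
  split=> [no_cyc|lt_nk /disjoint_cycles_bound]; last by rewrite leqNgt lt_nk.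
  by rewrite ltnNge; apply/negP => /(has_disjoint_cycles_suff hS).
(* The two inequalities differ by adding 3l + 3a to both sides, over the integers so that the
   subtractions are exact. *)
split=> //; rewrite main; clear; lia.
Qed.
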